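(* Let $n\ge1$, $m\ge2$, $V=\mathbb{R}^{2n}$ with its standard symplectic form $\omega$, and let $G_2=\mathrm{ASp}(2n,\mathbb{R})=\mathrm{Sp}(2n,\mathbb{R})\ltimes\mathbb{R}^{2n}$ (linear symplectic maps together with translations) act diagonally on $V^{\times m}$. For $(A_1,\dots,A_m)\in V^{\times m}$ put $a_{ij}=\omega(A_i,A_j)$. Then the functions $a_{ij}+a_{jk}+a_{ki}$ are $G_2$-invariant; the field of $G_2$-invariant real rational functions on $V^{\times m}$ is generated by the $\mathrm{Sp}(2n,\mathbb{R})$-joint invariants of the $(m-1)$-tuple obtained by translating $A_1$ to the origin, i.e. by $\omega(A_i-A_1,A_j-A_1)=a_{1i}+a_{ij}+a_{j1}$, $2\le i<j\le m$; and this field has transcendence degree $d(m-1,n)$ over $\mathbb{R}$, where $$d(m,n)=\begin{cases}2nm-n(2n+1)&\text{for } m\ge 2n,\\ \binom m2&\text{for } m\le 2n.\end{cases}$$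
   Context: $V=\mathbb{R}^{2n}$ has coordinates $(x^1,\dots,x^n,y^1,\dots,y^n)$ and $\omega=dx^1\wedge dy^1+\dots+dx^n\wedge dy^n$. The convention $a_{ji}=-a_{ij}$ holds by skew-symmetry of $\omega$. *)

(* Defs.v *)
From mathcomp Require Import all_boot all_order all_algebra.
From mathcomp Require Import mpoly.
From mathcomp Require Import reals.

Set Implicit Arguments.
Unset Strict Implicit.
Unset Printing Implicit Defensive.

Import GRing.Theory.
Local Open Scope ring_scope.

(* A vector of the symplectic space is a column of height n + n whose upper   *)
(* half is (x^1, .., x^n) and whose lower half is (y^1, .., y^n). The ring K  *)
(* is arbitrary so that the same formula applies both to real vectors and to  *)
(* vectors whose entries are rational functions.                              *)
Definition omega (K : comNzRingType) (n : nat) (u v : 'cV[K]_(n + n)) : K :=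
  \sum_(i < n) (u (lshift n i) 0 * v (rshift n i) 0
                - u (rshift n i) 0 * v (lshift n i) 0).

Definition symplectic (K : comNzRingType) (n : nat) (S : 'M[K]_(n + n)) : Prop :=
  forall u v : 'cV[K]_(n + n), omega (S *m u) (S *m v) = omega u v.

(* The diagonal action of v |-> S *m v + b on m-tuples of vectors.            *)
Definition affine_act (K : comNzRingType) (m n : nat)
    (S : 'M[K]_(n + n)) (b : 'cV[K]_(n + n)) (A : 'I_m -> 'cV[K]_(n + n)) :
    'I_m -> 'cV[K]_(n + n) :=
  fun i => S *m A i + b.

Definition pairing (K : comNzRingType) (m n : nat)
    (A : 'I_m -> 'cV[K]_(n + n)) (i j : 'I_m) : K := omega (A i) (A j).

Section RationalFunctions.

Variable R : realType.

(* The field R(V^m): fractions of real polynomials in the m * 2n coordinates, *)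
(* the k-th coordinate of the i-th vector being the variable of index         *)
(* mxvec_index i k.                                                           *)
Definition ratfun (m n : nat) := {fraction {mpoly R[m * (n + n)]}}.

Definition ratpoly (m n : nat) (p : {mpoly R[m * (n + n)]}) : ratfun m n :=
  FracField.tofrac p.

Definition ratconst (m n : nat) (c : R) : ratfun m n := ratpoly (mpolyC _ c).

(* The tautological point of V^m over R(V^m): its entries are the coordinate  *)
(* functions, so a formula in A_1, .., A_m evaluated at it is the function    *)
(* on V^m that this formula defines.                                          *)
Definition generic_point (m n : nat) : 'I_m -> 'cV[ratfun m n]_(n + n) :=
  fun i => \col_k ratpoly (mpolyX R (mnm1 (mxvec_index i k))).

(* Evaluation of a polynomial function on V^m' at a point of V^m' with        *)
(* coordinates in R(V^m).                                                     *)
Definition poly_pullback (m m' n : nat)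
    (P : 'I_m' -> 'cV[ratfun m n]_(n + n)) (p : {mpoly R[m' * (n + n)]}) :
    ratfun m n :=
  mmap (@ratconst m n) (fun v => mxvec (\matrix_(i, k) P i k 0) 0 v) p.

(* The composite f \o P of a rational function f on V^m' with the rational    *)
(* map P from V^m to V^m'. The result does not depend on the fraction chosen  *)
(* for f as long as P is dominant, for then no nonzero denominator vanishes   *)
(* at P; it is only used for invertible affine maps of V^m and for the        *)
(* surjection (A_1, .., A_m) |-> (A_2 - A_1, .., A_m - A_1).                  *)
Definition pullback (m m' n : nat)
    (P : 'I_m' -> 'cV[ratfun m n]_(n + n)) (f : ratfun m' n) : ratfun m n :=
  poly_pullback P (\n_(repr f)) / poly_pullback P (\d_(repr f)).

(* f \o g for the diagonal action of g : v |-> S *m v + b.                    *)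
Definition ratfun_act (m n : nat) (S : 'M[R]_(n + n)) (b : 'cV[R]_(n + n))
    (f : ratfun m n) : ratfun m n :=
  pullback (affine_act (map_mx (@ratconst m n) S) (map_mx (@ratconst m n) b)
                       (@generic_point m n)) f.

Definition Sp_invariant (m n : nat) (f : ratfun m n) : Prop :=
  forall S : 'M[R]_(n + n), symplectic S -> ratfun_act S 0 f = f.

Definition ASp_invariant (m n : nat) (f : ratfun m n) : Prop :=
  forall (S : 'M[R]_(n + n)) (b : 'cV[R]_(n + n)),
    symplectic S -> ratfun_act S b f = f.

(* f belongs to R(X), the smallest subfield containing R and X.               *)
Definition generated_field (m n : nat) (X : ratfun m n -> Prop)
    (f : ratfun m n) : Prop :=
  forall F : {pred ratfun m n}, GRing.divring_closed F ->
    (forall c, ratconst m n c \in F) -> (forall x, X x -> x \in F) -> f \in F.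

Definition algebraically_independent (m n d : nat) (t : 'I_d -> ratfun m n) :
    Prop :=
  forall p : {mpoly R[d]}, mmap (@ratconst m n) t p = 0 -> p = 0.

Definition algebraic_over (m n : nat) (L : ratfun m n -> Prop)
    (f : ratfun m n) : Prop :=
  exists p : {poly ratfun m n},
    [/\ p != 0, forall k, L p`_k & root p f].

(* The subfield L has a transcendence basis over R with d elements.           *)
Definition has_trdeg (m n : nat) (L : ratfun m n -> Prop) (d : nat) : Prop :=
  exists t : 'I_d -> ratfun m n,
    [/\ forall i, L (t i), algebraically_independent t &
        forall f, L f ->
          algebraic_over (generated_field (fun x => exists i, x = t i)) f].

End RationalFunctions.

(* The subtraction is not truncated when 2 * n <= m, and the two formulas     *)
(* agree for m = 2 * n.                                                       *)
Definition d_inv (m n : nat) : nat :=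
  if (2 * n <= m)%N then (2 * n * m - n * (2 * n + 1))%N else 'C(m, 2).

Lemma d_inv_small (m n : nat) : (m <= 2 * n)%N -> d_inv m n = 'C(m, 2).
Proof.
rewrite /d_inv leq_eqVlt => /orP[/eqP->|lt_m_2n]; last by rewrite leqNgt lt_m_2n.
rewrite leqnn bin2 [in RHS]mul2n -doubleMl doubleK -mul2n.
rewrite -mulnA mulnCA -mulnBr; congr (_ * _)%N.
by rewrite subnDA [X in (X - _ - _)%N]mul2n -addnn addnK subn1.
Qed.

(* Main.v *)
Require Import Defs.
From HB Require Import structures.
From mathcomp Require Import all_boot all_order all_algebra.
From mathcomp Require Import mpoly.
From mathcomp Require Import reals.
From mathcomp Require boolp.
From mathcomp Require Import ring zify.

Set Implicit Arguments.
Unset Strict Implicit.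
Unset Printing Implicit Defensive.

Import GRing.Theory Num.Theory.
Local Open Scope ring_scope.

(* Let K = R(V^m), let X be the generic point, T_i the differences with X_1   *)
(* and F a subfield containing R and the omega (T_i, T_j) with i < j and      *)
(* i <= 2n. The vectors T_i are in general position and their Gram matrix has *)
(* entries in F, so by Darboux's theorem over F there is a symplectic S over  *)
(* K for which the S T_i have entries in F.                                   *)
(*   If f = p / q is invariant under the real affine symplectic group then    *)
(* p(g X) q(X) = p(X) q(g X) holds for real g, hence for g over K, because    *)
(* Sp(2n, R) is Zariski dense in Sp(2n, K). The value q(S (X - X_1)) may      *)
(* vanish, but by density again q(g S (X - X_1) + b) is nonzero for some real *)
(* g and b; evaluating f = p / q at this point, with entries in F, gives f in *)
(* F.                                                                         *)
(*   The omega (T_i, T_j) with i < j and i <= 2n are algebraically            *)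
(* independent, as their values at real points are Zariski dense: a Gram      *)
(* matrix with an invertible leading 2n x 2n block can be prescribed, again   *)
(* by Darboux's theorem. So the invariant field is purely transcendental.     *)

(** * Polynomial functions on matrix spaces *)

(** Two facts about K = R(V^m) carry the proof. First, K is formally real ([frac_formally_real]),
    and over such a field real symplectic matrices are Zariski dense among all symplectic ones
    ([symplectic_dense]): a shear makes the upper left block invertible, and the matrix then factors
    into shears and a Levi element, which are parametrized by matrix spaces. Hence polynomial
    identities in a real affine symplectic map remain true for maps over K ([affine_dense]). Second,
    Darboux's theorem over a subfield F: vectors over K whose relevant pairings lie in F are the
    image, under one symplectic matrix over K, of vectors with coordinates in F ([gram_factor_free],
    [gram_factor_span]). Together they give [ASp_invariant_mem]: an invariant fraction may be
    evaluated at a symplectic translate of the generic point with coordinates in F, so its value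
    lies in F. This one inclusion yields both generation statements and the spanning half of the
    transcendence degree. The other half is [omega_alg_independent], since real Gram matrices are
    flexible enough, and [card_basis_pairs] counts the basis. *)

Inductive polyfun (K : comNzRingType) (a b : nat) : ('M[K]_(a, b) -> K) -> Prop :=
| polyfun_cst c : polyfun (fun=> c)
| polyfun_entry i j : polyfun (fun X => X i j)
| polyfun_add f g : polyfun f -> polyfun g -> polyfun (fun X => f X + g X)
| polyfun_mul f g : polyfun f -> polyfun g -> polyfun (fun X => f X * g X)
| polyfun_ext f g : f =1 g -> polyfun f -> polyfun g.

Definition polymap (K : comNzRingType) (a b c d : nat)
    (F : 'M[K]_(a, b) -> 'M[K]_(c, d)) : Prop :=
  forall i j, polyfun (fun X => F X i j).

Section PolynomialFunctions.

Variables (K : comNzRingType) (a b : nat).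
Implicit Types f g : 'M[K]_(a, b) -> K.

Lemma polyfun_opp f : polyfun f -> polyfun (fun X => - f X).
Proof.
move=> pf; apply: (polyfun_ext (f := fun X => -1 * f X)).
  by move=> X; rewrite mulN1r.
exact: polyfun_mul (polyfun_cst _ _ _) pf.
Qed.

Lemma polyfun_sub f g : polyfun f -> polyfun g -> polyfun (fun X => f X - g X).
Proof. by move=> pf pg; apply: polyfun_add => //; apply: polyfun_opp. Qed.

Lemma polyfun_sum I (r : seq I) (P : pred I) (F : I -> 'M[K]_(a, b) -> K) :
  (forall i, polyfun (F i)) -> polyfun (fun X => \sum_(i <- r | P i) F i X).
Proof.
move=> pF; elim: r => [|i r IHr].
  by apply: (polyfun_ext (f := fun=> 0)) (polyfun_cst _ _ _) => X; rewrite big_nil.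
apply: (polyfun_ext (f := fun X => (if P i then F i X else 0)
                                   + \sum_(j <- r | P j) F j X)).
  by move=> X; rewrite big_cons; case: ifP => //; rewrite add0r.
by apply: polyfun_add IHr; case: (P i) => //; apply: polyfun_cst.
Qed.

Lemma polyfun_prod I (r : seq I) (P : pred I) (F : I -> 'M[K]_(a, b) -> K) :
  (forall i, polyfun (F i)) -> polyfun (fun X => \prod_(i <- r | P i) F i X).
Proof.
move=> pF; elim: r => [|i r IHr].
  by apply: (polyfun_ext (f := fun=> 1)) (polyfun_cst _ _ _) => X; rewrite big_nil.
apply: (polyfun_ext (f := fun X => (if P i then F i X else 1)
                                   * \prod_(j <- r | P j) F j X)).
  by move=> X; rewrite big_cons; case: ifP => //; rewrite mul1r.
by apply: polyfun_mul IHr; case: (P i) => //; apply: polyfun_cst.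
Qed.

Lemma polyfun_exp f k : polyfun f -> polyfun (fun X => f X ^+ k).
Proof.
move=> pf; elim: k => [|k IHk]; first exact: polyfun_cst.
apply: (polyfun_ext (f := fun X => f X * f X ^+ k)); last exact: polyfun_mul.
by move=> X; rewrite exprS.
Qed.

Section Maps.
Variables (c d e : nat).

Lemma polyfun_comp f (F : 'M[K]_(c, d) -> 'M[K]_(a, b)) :
  polyfun f -> polymap F -> polyfun (fun X => f (F X)).
Proof.
move=> pf pF; elim: pf => [x|i j|{}f g _ pf _ pg|{}f g _ pf _ pg|{}f g efg _ pf].
- exact: polyfun_cst.
- exact: pF.
- exact: polyfun_add.
- exact: polyfun_mul.
- by apply: polyfun_ext pf => X /=; rewrite efg.
Qed.

Lemma polymap_id : polymap (fun X : 'M[K]_(a, b) => X).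
Proof. by move=> i j; apply: polyfun_entry. Qed.

Lemma polymap_cst (C : 'M[K]_(c, d)) : polymap (fun X : 'M[K]_(a, b) => C).
Proof. by move=> i j; apply: polyfun_cst. Qed.

Lemma polymap_add (F G : 'M[K]_(a, b) -> 'M[K]_(c, d)) :
  polymap F -> polymap G -> polymap (fun X => F X + G X).
Proof.
move=> pF pG i j; apply: (polyfun_ext (f := fun X => F X i j + G X i j)).
  by move=> X; rewrite mxE.
exact: polyfun_add.
Qed.

Lemma polymap_scale f (F : 'M[K]_(a, b) -> 'M[K]_(c, d)) :
  polyfun f -> polymap F -> polymap (fun X => f X *: F X).
Proof.
move=> pf pF i j; apply: (polyfun_ext (f := fun X => f X * F X i j)).
  by move=> X; rewrite mxE.
exact: polyfun_mul.
Qed.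

Lemma polymap_tr (F : 'M[K]_(a, b) -> 'M[K]_(c, d)) :
  polymap F -> polymap (fun X => (F X)^T).
Proof.
by move=> pF i j; apply: polyfun_ext (pF j i) => X; rewrite mxE.
Qed.

Lemma polymap_mul (F : 'M[K]_(a, b) -> 'M[K]_(c, d))
    (G : 'M[K]_(a, b) -> 'M[K]_(d, e)) :
  polymap F -> polymap G -> polymap (fun X => F X *m G X).
Proof.
move=> pF pG i j; apply: (polyfun_ext (f := fun X => \sum_k F X i k * G X k j)).
  by move=> X; rewrite mxE.
by apply: polyfun_sum => k; apply: polyfun_mul.
Qed.

End Maps.

Lemma polyfun_det k (F : 'M[K]_(a, b) -> 'M[K]_k) :
  polymap F -> polyfun (fun X => \det (F X)).
Proof.
move=> pF; apply: polyfun_sum => s; apply: polyfun_mul; first exact: polyfun_cst.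
by apply: polyfun_prod => i; apply: pF.
Qed.

Lemma polymap_adj k (F : 'M[K]_(a, b) -> 'M[K]_k) :
  polymap F -> polymap (fun X => \adj (F X)).
Proof.
move=> pF i j.
apply: (polyfun_ext (f := fun X => cofactor (F X) j i)).
  by move=> X; rewrite mxE.
apply: polyfun_mul; first exact: polyfun_cst.
apply: polyfun_det => u v.
by apply: (polyfun_ext (f := fun X => F X (lift j u) (lift i v))) => // X; rewrite !mxE.
Qed.

Lemma polymap_block c1 c2 d1 d2 (F1 : 'M[K]_(a, b) -> 'M[K]_(c1, d1))
    (F2 : 'M[K]_(a, b) -> 'M[K]_(c1, d2)) (F3 : 'M[K]_(a, b) -> 'M[K]_(c2, d1))
    (F4 : 'M[K]_(a, b) -> 'M[K]_(c2, d2)) :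
  polymap F1 -> polymap F2 -> polymap F3 -> polymap F4 ->
  polymap (fun X => block_mx (F1 X) (F2 X) (F3 X) (F4 X)).
Proof.
move=> p1 p2 p3 p4 i j.
case: (split_ordP i) => {}i ->; case: (split_ordP j) => {}j ->.
- by apply: polyfun_ext (p1 i j) => X; rewrite block_mxEul.
- by apply: polyfun_ext (p2 i j) => X; rewrite block_mxEur.
- by apply: polyfun_ext (p3 i j) => X; rewrite block_mxEdl.
- by apply: polyfun_ext (p4 i j) => X; rewrite block_mxEdr.
Qed.

(** Restriction to a line reduces questions of vanishing to counting roots of a univariate
    polynomial. *)
Lemma polyfun_line f (X Y : 'M[K]_(a, b)) :
  polyfun f -> exists p : {poly K}, forall s, p.[s] = f (X + s *: Y).
Proof.
elim=> [c|i j|{}f g _ [p Hp] _ [q Hq]|{}f g _ [p Hp] _ [q Hq]|{}f g efg _ [p Hp]].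
- by exists c%:P => s; rewrite hornerC.
- by exists ((X i j)%:P + (Y i j)%:P * 'X) => s; rewrite !hornerE !mxE mulrC.
- by exists (p + q) => s; rewrite hornerD Hp Hq.
- by exists (p * q) => s; rewrite hornerM Hp Hq.
- by exists p => s; rewrite Hp efg.
Qed.

End PolynomialFunctions.

(** * Vanishing of polynomial functions in characteristic 0 *)

Section Zeros.

Variables (R : numFieldType) (K : fieldType) (h : {rmorphism R -> K}).

Lemma poly_nat_zeros (p : {poly K}) (e : nat -> nat) :
  injective e -> (forall k : nat, p.[(e k)%:R] = 0) -> p = 0.
Proof.
move=> inje p0.
have inj_nat : injective (fun k : nat => (e k)%:R : K).
  move=> k l; rewrite -[LHS](rmorph_nat h) -[RHS](rmorph_nat h).
  by move/fmorph_inj/eqP; rewrite eqr_nat => /eqP /inje.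
apply: (@roots_geq_poly_eq0 _ p [seq (e k)%:R | k <- seq.iota 0 (size p)]).
- by apply/allP => _ /mapP[k _ ->]; apply/rootP.
- by rewrite map_inj_uniq ?iota_uniq.
- by rewrite size_map size_iota.
Qed.

Lemma polyfun_eq0_ext a b (f : 'M[K]_(a, b) -> K) :
  polyfun f -> (forall X : 'M[R]_(a, b), f (map_mx h X) = 0) ->
  forall X, f X = 0.
Proof.
move=> pf f0 X.
(* The entries are freed one at a time. *)
have ext (s : seq ('I_a * 'I_b)) : forall X : 'M[K]_(a, b),
    (forall i j, (i, j) \notin s -> exists r, X i j = h r) -> f X = 0.
  elim: s => [|[i0 j0] s IHs] {}X HX.
    have [Y HY] : exists Y : 'M[R]_(a, b), X = map_mx h Y.
      have /fin_all_exists[g Hg] (ij : 'I_a * 'I_b) : exists r, X ij.1 ij.2 = h r.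
        exact: HX.
      by exists (\matrix_(i, j) g (i, j)); apply/matrixP => i j; rewrite !mxE -Hg.
    by rewrite HY f0.
  pose D := delta_mx i0 j0 : 'M[K]_(a, b).
  have [p Hp] := polyfun_line (X - X i0 j0 *: D) D pf.
  suff p0 : p = 0 by have := Hp (X i0 j0); rewrite p0 horner0 subrK.
  (* Natural numbers come from R, so at these values of the freed entry the induction hypothesis
     applies. *)
  apply: (@poly_nat_zeros p id) => // k; rewrite Hp; apply: IHs => i j ijNs.
  rewrite !mxE; have [ij|ijn] := boolP ((i == i0) && (j == j0)).
    case/andP: ij => /eqP-> /eqP->; exists k%:R.
    by rewrite rmorph_nat !mulr1 subrr add0r.
  have [|r Hr] := HX i j; first by rewrite inE negb_or xpair_eqE ijn.
  by exists r; rewrite !mulr0 subr0 addr0.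
apply: (ext (enum [set: 'I_a * 'I_b])) => i j.
by rewrite mem_enum inE.
Qed.

(** On the line from a point where g is nonzero to X, f and g become univariate polynomials with
    product 0, and K[t] is a domain. *)
Lemma polyfun_idomain a b (f g : 'M[K]_(a, b) -> K) :
  polyfun f -> polyfun g -> (forall X, f X * g X = 0) ->
  (exists X, g X != 0) -> forall X, f X = 0.
Proof.
move=> pf pg fg0 [X0 gX0] X.
have [p Hp] := polyfun_line X0 (X - X0) pf.
have [q Hq] := polyfun_line X0 (X - X0) pg.
have pq0 : p * q = 0.
  by apply: (@poly_nat_zeros _ id) => // k; rewrite hornerM Hp Hq fg0.
have qn0 : q != 0.
  apply: contraNneq gX0 => q0; rewrite -[X0]addr0 -(scale0r (X - X0)) -Hq q0.
  by rewrite horner0.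
move/eqP: pq0; rewrite mulf_eq0 (negPf qn0) orbF => /eqP p0.
by have := Hp 1; rewrite p0 horner0 scale1r addrC subrK.
Qed.

End Zeros.

(** * Zariski density of the real symplectic group *)

Definition symp_mx (K : comNzRingType) (n : nat) : 'M[K]_(n + n) :=
  block_mx 0 1%:M (- 1%:M) 0.

Section SymplecticMatrices.

Variables (K : comNzRingType) (n : nat).
Local Notation J := (symp_mx K n).

Lemma omegaE (u v : 'cV[K]_(n + n)) : omega u v = (u^T *m J *m v) 0 0.
Proof.
rewrite /omega -[u]vsubmxK -[v]vsubmxK tr_col_mx mul_row_block !mulmx0 add0r addr0.
rewrite mulmxN !mulmx1 mul_row_col !mxE addrC -big_split /=.
apply: eq_bigr => i _; rewrite !mxE.
by rewrite !(unsplitK (inl _)) !(unsplitK (inr _)) !mxE mulNr.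
Qed.

Lemma symp_mxK : J *m J = - 1%:M.
Proof.
rewrite mulmx_block !mul0mx !mulmx0 mul1mx mulmx1 !addr0 !add0r.
by rewrite (scalar_mx_block n n) opp_block_mx !oppr0.
Qed.

Lemma tr_symp_mx : J^T = - J.
Proof.
by rewrite tr_block_mx !linearN /= !trmx0 trmx1 opp_block_mx !oppr0 opprK.
Qed.

Lemma symplecticP (S : 'M[K]_(n + n)) : symplectic S <-> S^T *m J *m S = J.
Proof.
have form (M : 'M[K]_(n + n)) (u v : 'cV_(n + n)) :
    (S *m u)^T *m M *m (S *m v) = u^T *m (S^T *m M *m S) *m v.
  by rewrite trmx_mul !mulmxA.
split=> [sS|sS u v]; last by rewrite !omegaE form sS.
apply/matrixP => i j.
have entry (M : 'M[K]_(n + n)) :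
    ((delta_mx i 0 : 'cV_(n + n))^T *m M *m (delta_mx j 0 : 'cV_(n + n))) 0 0
      = M i j.
  by rewrite trmx_delta -rowE -colE !mxE.
by rewrite -[LHS]entry -form -omegaE sS omegaE entry.
Qed.

Lemma symplectic_mul (S T : 'M[K]_(n + n)) :
  symplectic S -> symplectic T -> symplectic (S *m T).
Proof. by move=> sS sT u v; rewrite -!mulmxA sS sT. Qed.

Lemma symplectic_block (a b c d : 'M[K]_n) :
  symplectic (block_mx a b c d) <->
  [/\ a^T *m c = c^T *m a, a^T *m d - c^T *m b = 1%:M & b^T *m d = d^T *m b].
Proof.
rewrite symplecticP tr_block_mx !mulmx_block !mulmx0 !add0r !addr0 !mulmx1.
rewrite !mulmxN !mulmx1 !mulNmx; split.
  case/eq_block_mx => e1 e2 _ e4; split.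
  - by apply/eqP; rewrite -subr_eq0 addrC e1.
  - by rewrite addrC e2.
  - by apply/eqP; rewrite -subr_eq0 addrC e4.
case=> e1 e2 e3; congr block_mx.
- by rewrite e1 addNr.
- by rewrite addrC.
- rewrite -[in RHS]trmx1 -e2 linearB /= !trmx_mul !trmxK opprB.
  by rewrite addrC.
- by rewrite e3 addNr.
Qed.

Definition upper_shear (B : 'M[K]_n) : 'M[K]_(n + n) := block_mx 1%:M B 0 1%:M.
Definition lower_shear (C : 'M[K]_n) : 'M[K]_(n + n) := block_mx 1%:M 0 C 1%:M.

Lemma upper_shearP (B : 'M[K]_n) : symplectic (upper_shear B) <-> B^T = B.
Proof.
rewrite symplectic_block trmx1 trmx0 !mulmx0 !mul0mx !mulmx1 mul1mx subr0.
by split=> [[]|].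
Qed.

Lemma lower_shearP (C : 'M[K]_n) : symplectic (lower_shear C) <-> C^T = C.
Proof.
rewrite symplectic_block trmx1 trmx0 !mulmx0 !mul0mx !mulmx1 mul1mx subr0.
by split=> [[]|].
Qed.

Lemma upper_shearK (B : 'M[K]_n) : upper_shear (- B) *m upper_shear B = 1%:M.
Proof.
by rewrite mulmx_block !(mulmx0, mul0mx, mulmx1, mul1mx, addr0, add0r) subrr
  -scalar_mx_block.
Qed.

Lemma lower_shearK (C : 'M[K]_n) : lower_shear (- C) *m lower_shear C = 1%:M.
Proof.
by rewrite mulmx_block !(mulmx0, mul0mx, mulmx1, mul1mx, addr0, add0r) addNr
  -scalar_mx_block.
Qed.

End SymplecticMatrices.

(** The symplectic maps preserving both Lagrangian halves of V; with the shears they give the block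
    LDU factorization. *)
Definition levi (K : comUnitRingType) (n : nat) (a : 'M[K]_n) : 'M[K]_(n + n) :=
  block_mx a 0 0 (invmx a)^T.

Lemma levi_symplectic (K : comUnitRingType) (n : nat) (a : 'M[K]_n) :
  a \in unitmx -> symplectic (levi a).
Proof.
move=> ua; rewrite symplectic_block !trmx0 !mulmx0 !mul0mx -trmx_mul mulVmx //.
by rewrite trmx1 subr0.
Qed.

Lemma map_symp_mx (R K : comNzRingType) (h : {rmorphism R -> K}) n :
  map_mx h (symp_mx R n) = symp_mx K n.
Proof. by rewrite map_block_mx map_mx0 map_mxN map_mx1. Qed.

Lemma map_symplectic (R K : comNzRingType) (h : {rmorphism R -> K}) n
    (S : 'M[R]_(n + n)) :
  symplectic S -> symplectic (map_mx h S).
Proof.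
move/symplecticP => sS; apply/symplecticP.
by rewrite -(map_symp_mx h) map_trmx -!map_mxM sS.
Qed.

Lemma symp_mx_unit (K : comUnitRingType) n : symp_mx K n \in unitmx.
Proof.
have : symp_mx K n *m (- symp_mx K n) = 1%:M by rewrite mulmxN symp_mxK opprK.
by case/mulmx1_unit.
Qed.

Lemma symplectic_unit (K : comUnitRingType) n (S : 'M[K]_(n + n)) :
  symplectic S -> S \in unitmx.
Proof.
move/symplecticP => sS.
have : S^T *m symp_mx K n *m S \in unitmx by rewrite sS symp_mx_unit.
by rewrite unitmx_mul => /andP[].
Qed.

Lemma symplectic_inv (K : comUnitRingType) n (S : 'M[K]_(n + n)) :
  symplectic S -> symplectic (invmx S).
Proof.
move=> sS u v; have uS := symplectic_unit sS.
by rewrite -[LHS]sS !mulmxA mulmxV // !mul1mx.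
Qed.

Section Density.

Variables (R : numFieldType) (K : fieldType) (h : {rmorphism R -> K}) (n : nat).

(* The Zariski closure of Sp(2n, R) in the matrices over K. *)
Definition real_dense (g : 'M[K]_(n + n)) : Prop :=
  forall f : 'M[K]_(n + n) -> K, polyfun f ->
    (forall S, symplectic S -> f (map_mx h S) = 0) -> f g = 0.

(** The usual argument that the closure of a group is closed under products: one factor is moved at
    a time while the other stays fixed. *)
Lemma real_dense_mul g1 g2 :
  real_dense g1 -> real_dense g2 -> real_dense (g1 *m g2).
Proof.
move=> d1 d2 f pf f0.
apply: (d2 (fun X => f (g1 *m X))).
  apply: polyfun_comp pf _; apply: polymap_mul; last exact: polymap_id.
  exact: polymap_cst.
move=> S sS; apply: (d1 (fun X => f (X *m map_mx h S))).
  apply: polyfun_comp pf _; apply: polymap_mul; first exact: polymap_id.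
  exact: polymap_cst.
by move=> S' sS'; rewrite -map_mxM f0 //; apply: symplectic_mul.
Qed.

(** F is a parametrization available over every ring and compatible with h; density of the real
    matrices in the parameter space passes to its image. *)
Lemma real_dense_image (F : forall L : comNzRingType, 'M[L]_n -> 'M[L]_(n + n)) :
  polymap (F K) -> (forall X, symplectic (F R X)) ->
  (forall X, F K (map_mx h X) = map_mx h (F R X)) ->
  forall X, real_dense (F K X).
Proof.
move=> pF sF hF X f pf f0.
apply: (polyfun_eq0_ext (h := h) (f := fun X => f (F K X))).
  exact: polyfun_comp.
by move=> Y; rewrite hF f0.
Qed.

(** Parametrizes the symmetric matrices by the whole matrix space, where density is known. *)
Lemma half_tr (B : 'M[K]_n) : B^T = B -> exists X, B = X + X^T.
Proof.
move=> sB; exists (2^-1 *: B); rewrite linearZ /= sB -scalerDl -[2^-1]mul1r -mulrDl.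
have n2 : 2 != 0 :> K by rewrite -(rmorph_nat h) fmorph_eq0 pnatr_eq0.
by rewrite mulfV ?scale1r.
Qed.

Lemma upper_shear_dense (B : 'M[K]_n) : B^T = B -> real_dense (upper_shear B).
Proof.
case/half_tr => X ->.
apply: (real_dense_image (F := fun L X => upper_shear (X + X^T))) => {X}.
- apply: polymap_block; try exact: polymap_cst.
  by apply: polymap_add; [|apply: polymap_tr]; apply: polymap_id.
- by move=> X; apply/upper_shearP; rewrite linearD /= trmxK addrC.
- by move=> X; rewrite map_block_mx map_mx1 map_mx0 map_mxD -map_trmx.
Qed.

Lemma lower_shear_dense (C : 'M[K]_n) : C^T = C -> real_dense (lower_shear C).
Proof.
case/half_tr => X ->.
apply: (real_dense_image (F := fun L X => lower_shear (X + X^T))) => {X}.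
- apply: polymap_block; try exact: polymap_cst.
  by apply: polymap_add; [|apply: polymap_tr]; apply: polymap_id.
- by move=> X; apply/lower_shearP; rewrite linearD /= trmxK addrC.
- by move=> X; rewrite map_block_mx map_mx1 map_mx0 map_mxD -map_trmx.
Qed.

(** [levi a] is rational rather than polynomial in a, but its product with det a is polynomial, by
    the adjugate formula. *)
Lemma levi_clear_denom (f : 'M[K]_(n + n) -> K) : polyfun f ->
  exists N (g : 'M[K]_n -> K), polyfun g /\
    forall a, \det a != 0 -> f (levi a) = g a / \det a ^+ N.
Proof.
have pdet k : polyfun (fun X : 'M[K]_n => \det X ^+ k).
  by apply: polyfun_exp; apply: polyfun_det; apply: polymap_id.
elim=> [c|i j|{}f g _ [N1 [f1 [p1 e1]]] _ [N2 [g2 [p2 e2]]]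
       |{}f g _ [N1 [f1 [p1 e1]]] _ [N2 [g2 [p2 e2]]]|{}f g efg _ [N [f' [pf' ef']]]].
- exists 0, (fun=> c); split; first exact: polyfun_cst.
  by move=> a _; rewrite divr1.
- exists 1%N, (fun a => block_mx (\det a *: a) 0 0 ((\adj a)^T) i j); split.
    apply: polymap_block; try exact: polymap_cst.
      apply: polymap_scale; last exact: polymap_id.
      by apply: polyfun_det; apply: polymap_id.
    by apply: polymap_tr; apply: polymap_adj; apply: polymap_id.
  move=> a da; have ua : a \in unitmx by rewrite unitmxE unitfE.
  have -> : levi a = (\det a)^-1 *: block_mx (\det a *: a) 0 0 ((\adj a)^T).
    rewrite scale_block_mx !scaler0 scalerA mulVf // scale1r /levi /invmx ua.
    by rewrite linearZ.
  by rewrite mxE mulrC expr1.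
- exists (N1 + N2)%N, (fun a => f1 a * \det a ^+ N2 + g2 a * \det a ^+ N1); split.
    by apply: polyfun_add; apply: polyfun_mul.
  move=> a da; rewrite e1 // e2 // exprD.
  by rewrite addf_div ?expf_neq0.
- exists (N1 + N2)%N, (fun a => f1 a * g2 a); split; first exact: polyfun_mul.
  by move=> a da; rewrite e1 // e2 // exprD mulf_div.
- by exists N, f'; split=> // a da; rewrite -efg ef'.
Qed.

Lemma levi_dense (a : 'M[K]_n) : a \in unitmx -> real_dense (levi a).
Proof.
move=> ua f pf f0; have [N [g [pg eg]]] := levi_clear_denom pf.
(* The factor det X makes the identity hold at singular real X too, so density applies to the whole
   matrix space. *)
have gdet0 : forall X, g X * \det X = 0.
  apply: (polyfun_eq0_ext (h := h)).
    by apply: polyfun_mul => //; apply: polyfun_det; apply: polymap_id.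
  move=> X; rewrite det_map_mx.
  have [->|dX] := eqVneq (\det X) 0; first by rewrite rmorph0 mulr0.
  have dhX : \det (map_mx h X) != 0 by rewrite det_map_mx fmorph_eq0.
  have uX : X \in unitmx by rewrite unitmxE unitfE.
  have := eg _ dhX.
  have -> : levi (map_mx h X) = map_mx h (levi X).
    by rewrite map_block_mx !map_mx0 -map_trmx map_invmx.
  rewrite f0; last exact: levi_symplectic.
  move/esym/eqP; rewrite mulf_eq0 invr_eq0 expf_eq0 (negPf dhX) andbF orbF.
  by move/eqP->; rewrite mul0r.
have da : \det a != 0 by rewrite -unitfE -unitmxE.
move/eqP: (gdet0 a); rewrite mulf_eq0 (negPf da) orbF => /eqP ga0.
by rewrite eg // ga0 mul0r.
Qed.

(** Block LDU factorization: with a invertible, the matrix is a lower shear by c a^-1, times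
    [levi a], times an upper shear. The symplectic relations make both shear blocks symmetric. *)
Lemma symplectic_dense_unit (a b c d : 'M[K]_n) :
  a \in unitmx -> symplectic (block_mx a b c d) -> real_dense (block_mx a b c d).
Proof.
move=> ua sS; have [ac _ _] := (symplectic_block a b c d).1 sS.
pose C := c *m invmx a.
have sC : C^T = C.
  apply: (can_inj (mulKmx (_ : a^T \in unitmx))); first by rewrite unitmx_tr.
  rewrite trmx_mul mulmxA trmx_inv mulmxV ?unitmx_tr // mul1mx.
  by rewrite mulmxA ac -mulmxA mulmxV // mulmx1.
pose S2 := levi (invmx a) *m (lower_shear (- C) *m block_mx a b c d).
have sS2 : symplectic S2.
  apply: symplectic_mul; first by apply: levi_symplectic; rewrite unitmx_inv.
  by apply: symplectic_mul => //; apply/lower_shearP; rewrite linearN /= sC.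
have [B [D ES2]] : exists B D, S2 = block_mx 1%:M B 0 D.
  rewrite /S2 !mulmx_block !(mulmx0, mul0mx, mulmx1, mul1mx, addr0, add0r).
  rewrite mulVmx // mulNmx -mulmxA mulVmx // mulmx1 addNr mulmx0.
  by eexists; eexists.
move: sS2; rewrite ES2 symplectic_block trmx1 trmx0.
rewrite !(mulmx0, mul0mx, mulmx1, mul1mx) subr0.
case=> _ D1; rewrite D1 trmx1 mulmx1 mul1mx => sB.
have -> : block_mx a b c d = lower_shear C *m (levi a *m upper_shear B).
  have -> : upper_shear B = S2 by rewrite ES2 D1.
  rewrite /S2 (mulmxA (levi a)).
  have -> : levi a *m levi (invmx a) = 1%:M.
    rewrite mulmx_block !(mulmx0, mul0mx, addr0, add0r) mulmxV // -trmx_mul.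
    by rewrite mulVmx ?unitmx_inv // trmx1 -scalar_mx_block.
  by rewrite mul1mx mulmxA -{1}(opprK C) lower_shearK mul1mx.
apply: real_dense_mul; first exact: lower_shear_dense.
by apply: real_dense_mul; [apply: levi_dense | apply: upper_shear_dense].
Qed.

Definition formally_real := forall k (v : 'rV[K]_k), v *m v^T = 0 -> v = 0.

(* For t real, (a - t c)^T (a + t c) = a^T a - t^2 c^T c because a^T c is     *)
(* symmetric, and at t^2 = -1 the right side is a^T a + c^T c, which is       *)
(* anisotropic.                                                               *)
Lemma exists_unit_shift (a b c d : 'M[K]_n) :
  formally_real -> symplectic (block_mx a b c d) ->
  exists t : R, a + h t *: c \in unitmx.
Proof.
move=> fr /symplectic_block[ac ad _].
have id_p : polyfun (fun X : 'M[K]_n => \det X).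
  by apply: polyfun_det; apply: polymap_id.
have [p Hp] := polyfun_line (a^T *m a) (- (c^T *m c)) id_p.
have pN1 : p.[-1] != 0.
  rewrite Hp scaleN1r opprK; apply/det0P => -[x xn0 x0].
  have := fr _ (row_mx (x *m a^T) (x *m c^T)).
  rewrite tr_row_mx mul_row_col !trmx_mul !trmxK.
  have -> : x *m a^T *m (a *m x^T) + x *m c^T *m (c *m x^T)
      = x *m (a^T *m a + c^T *m c) *m x^T by rewrite mulmxDr mulmxDl !mulmxA.
  rewrite x0 mul0mx => /(_ erefl).
  rewrite -[0 in RHS](row_mx0 _ _) => /eq_row_mx[xa xc].
  (* A row x killed by both a^T and c^T contradicts a^T d - c^T b = 1. *)
  case/eqP: xn0; rewrite -[x]mulmx1 -ad mulmxBr !mulmxA xa xc.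
  by rewrite !mul0mx subr0.
have [k Hk] : exists k : nat, a + h k%:R *: c \in unitmx.
  apply: boolp.contrapT => nk; case/eqP: pN1.
  suff -> : p = 0 by rewrite horner0.
  (* If a + k c were singular for every natural k, then p would vanish at all the squares k^2. *)
  apply: (@poly_nat_zeros _ _ h _ (fun k => k ^ 2)%N).
    by move=> k l /eqP; rewrite eqn_exp2r // => /eqP.
  move=> k; rewrite Hp.
  have -> : a^T *m a + (k ^ 2)%:R *: - (c^T *m c)
      = (a - h k%:R *: c)^T *m (a + h k%:R *: c).
    rewrite linearB linearZ /= mulmxBl !mulmxDr -!scalemxAl -!scalemxAr ac.
    rewrite opprD addrA addrK scalerN scalerA -rmorphM -natrM mulnn rmorph_nat.
    by [].
  rewrite det_mulmx; have [->|dn0] := eqVneq (\det (a + h k%:R *: c)) 0.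
    by rewrite mulr0.
  by case: nk; exists k; rewrite unitmxE unitfE.
by exists k%:R.
Qed.

(** The upper shear with scalar block t replaces a by a + t c, which is invertible for a suitable
    real t; this reduces to an invertible corner. *)
Lemma symplectic_dense (S : 'M[K]_(n + n)) :
  formally_real -> symplectic S -> real_dense S.
Proof.
move=> fr; rewrite -[S]submxK.
set a := ulsubmx S; set b := ursubmx S; set c := dlsubmx S; set d := drsubmx S.
move=> sS; have [t ut] := exists_unit_shift fr sS.
pose B : 'M[K]_n := (h t)%:M.
have sB : B^T = B by rewrite tr_scalar_mx.
have -> : block_mx a b c d = upper_shear (- B) *m (upper_shear B *m block_mx a b c d).
  by rewrite mulmxA upper_shearK mul1mx.
apply: real_dense_mul; first by apply: upper_shear_dense; rewrite linearN /= sB.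
have sS' : symplectic (upper_shear B *m block_mx a b c d).
  by apply: symplectic_mul => //; apply/upper_shearP.
move: sS'; rewrite /upper_shear mulmx_block => sS'.
by apply: symplectic_dense_unit => //; rewrite mul1mx mul_scalar_mx.
Qed.

End Density.

(** * Gram matrices and symplectic factorization *)

Section Darboux.

Variable (K : fieldType).
Hypothesis char2 : 2 != 0 :> K.

Lemma skew_swap m1 m2 n (G : 'M[K]_n) (u : 'M[K]_(m1, n)) (v : 'M[K]_(m2, n)) :
  G^T = - G -> u *m G *m v^T = - (v *m G *m u^T)^T.
Proof.
by move=> sG; rewrite !trmx_mul trmxK sG mulNmx mulmxN opprK mulmxA.
Qed.

Lemma skew_diag0 n (G : 'M[K]_n) (x : 'rV[K]_n) : G^T = - G -> x *m G *m x^T = 0.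
Proof.
move=> sG; apply/matrixP => i j.
have := congr1 (fun M : 'M_1 => M i j) (skew_swap x x sG).
rewrite !ord1 !mxE => /eqP.
rewrite -subr_eq0 opprK -mulr2n -mulr_natl mulf_eq0 (negPf char2) /= => /eqP.
exact.
Qed.

Lemma kermx_nontrivial m n (A : 'M[K]_(m, n)) :
  (n < m)%N -> exists2 x : 'rV[K]_m, x != 0 & x *m A = 0.
Proof.
move=> nm; have : kermx A != 0.
  by rewrite kermx_eq0 /row_free neq_ltn (leq_ltn_trans (rank_leq_col A) nm).
by move/rowV0Pn => [x /sub_kermxP xA xn0]; exists x.
Qed.

(** Symplectic Gram-Schmidt: for 2k < N some nonzero x is orthogonal to the k hyperbolic pairs
    already found, and nondegeneracy provides a partner y. *)
Lemma symplectic_family N k (G : 'M[K]_N) :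
  G^T = - G -> G \in unitmx -> (k + k <= N)%N ->
  exists e f : 'M[K]_(k, N),
    [/\ e *m G *m e^T = 0, f *m G *m f^T = 0 & e *m G *m f^T = 1%:M].
Proof.
move=> sG uG; elim: k => [|k IHk] kN.
  by exists 0, 0; split; apply/matrixP; case.
have [|e [f [ee ff ef]]] := IHk; first by apply: leq_trans kN; rewrite addnS ltnW.
have fe : f *m G *m e^T = - 1%:M.
  by rewrite skew_swap // ef trmx1.
have [|x xn0] := @kermx_nontrivial _ _ (G *m (col_mx e f)^T).
  by apply: leq_trans kN; rewrite addnS addSn.
rewrite tr_col_mx mul_mx_row mul_mx_row -row_mx0 => /eq_row_mx[].
rewrite !mulmxA => xe xf.
have [y xy] : exists y : 'rV[K]_N, x *m G *m y^T = 1%:M.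
  have /rV0Pn[i xGi] : x *m G != 0.
    by apply: contraNneq xn0 => xG0; rewrite -(mulmxK uG x) xG0 mul0mx.
  exists (((x *m G) 0 i)^-1 *: delta_mx 0 i).
  rewrite linearZ /= -scalemxAr trmx_delta -colE.
  by apply/matrixP => a b; rewrite !ord1 [LHS]mxE [col _ _ _ _]mxE [RHS]mxE mulVf.
(* Removing from y its components along the earlier pairs keeps its pairing with x, because x is
   orthogonal to them. *)
pose y' := y - (y *m G *m f^T) *m e + (y *m G *m e^T) *m f.
have ye' : y' *m G *m e^T = 0.
  rewrite /y' !mulmxDl !mulNmx -!mulmxA (mulmxA e) ee (mulmxA f) fe.
  by rewrite !mulmx0 subr0 !mulmxN mulmx1 !mulmxA subrr.
have yf' : y' *m G *m f^T = 0.
  rewrite /y' !mulmxDl !mulNmx -!mulmxA (mulmxA f) ff (mulmxA e) ef.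
  by rewrite !mulmx0 addr0 mulmx1 !mulmxA subrr.
have xy' : x *m G *m y'^T = 1%:M.
  have -> : y'^T = y^T - e^T *m (y *m G *m f^T)^T + f^T *m (y *m G *m e^T)^T.
    by rewrite -!trmx_mul -linearB -linearD.
  by rewrite mulmxDr mulmxBr !(mulmxA (x *m G)) xe xf !mul0mx subr0 addr0.
have fy' : f *m G *m y'^T = 0.
  rewrite -[LHS]trmxK [(_ *m y'^T)^T]trmx_mul [(f *m G)^T]trmx_mul trmxK sG mulNmx.
  by rewrite mulmxN mulmxA yf' oppr0 trmx0.
have ey' : e *m G *m y'^T = 0.
  rewrite -[LHS]trmxK [(_ *m y'^T)^T]trmx_mul [(e *m G)^T]trmx_mul trmxK sG mulNmx.
  by rewrite mulmxN mulmxA ye' oppr0 trmx0.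
exists (col_mx x e : 'M_(1 + k, N)), (col_mx y' f : 'M_(1 + k, N)).
have gram u1 (u2 : 'M_(k, N)) v1 (v2 : 'M_(k, N)) :
  (col_mx u1 u2 : 'M_(1 + k, N)) *m G *m (col_mx v1 v2 : 'M_(1 + k, N))^T
   = block_mx (u1 *m G *m v1^T) (u1 *m G *m v2^T) (u2 *m G *m v1^T) (u2 *m G *m v2^T).
  by rewrite mul_col_mx tr_col_mx mul_col_row.
have ex : e *m G *m x^T = 0.
  by rewrite skew_swap // xe trmx0 oppr0.
split; rewrite gram.
- by rewrite skew_diag0 // xe ex ee block_mx0.
- by rewrite skew_diag0 // yf' fy' ff block_mx0.
- by rewrite xy' xf ey' ef -scalar_mx_block.
Qed.

Lemma darboux n (G : 'M[K]_(n + n)) :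
  G^T = - G -> G \in unitmx ->
  exists2 C : 'M[K]_(n + n), C \in unitmx & C *m symp_mx K n *m C^T = G.
Proof.
move=> sG uG; have [e [f [ee ff ef]]] := symplectic_family sG uG (leqnn (n + n)).
pose P := col_mx e f.
have fe : f *m G *m e^T = - 1%:M.
  by rewrite skew_swap // ef trmx1.
have PG : P *m G *m P^T = symp_mx K n.
  by rewrite mul_col_mx tr_col_mx mul_col_row ee ff ef fe.
have uP : P \in unitmx.
  suff : P *m (- (G *m P^T *m symp_mx K n)) = 1%:M by case/mulmx1_unit.
  by rewrite mulmxN !mulmxA PG symp_mxK opprK.
exists (invmx P); first by rewrite unitmx_inv.
by rewrite -PG !mulmxA mulVmx // mul1mx trmx_inv mulmxK ?unitmx_tr.
Qed.

End Darboux.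

Section GramFactorization.

Variables (E K : fieldType) (h : {rmorphism E -> K}) (n : nat).
Hypothesis char2 : 2 != 0 :> E.
Local Notation J := (symp_mx K n).

Lemma gram_skew N (A : 'M[K]_(N, n + n)) (G : 'M[E]_N) :
  A *m J *m A^T = map_mx h G -> G^T = - G.
Proof.
move=> AG; apply: (map_mx_inj (f := h)); rewrite map_mxN -AG -map_trmx -AG.
by rewrite !trmx_mul trmxK tr_symp_mx mulNmx mulmxN mulmxA.
Qed.

(* The new vector is kept out of the span of A by choosing its pairings with  *)
(* A outside of the row space of G, or, if G is invertible, equal to 0.       *)
Lemma gram_extend1 N (A : 'M[K]_(N, n + n)) (G : 'M[E]_N) :
  row_free A -> A *m J *m A^T = map_mx h G -> (N < n + n)%N ->
  exists (v : 'rV[K]_(n + n)) (G1 : 'M[E]_(N + 1)),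
    row_free (col_mx A v) /\ col_mx A v *m J *m (col_mx A v)^T = map_mx h G1.
Proof.
move=> fA AG ltN; have sJ := tr_symp_mx K n.
have uJ : J \in unitmx := symp_mx_unit K n.
have gram (v : 'rV[K]_(n + n)) (c : 'rV[E]_N) : v *m J *m A^T = map_mx h c ->
    col_mx A v *m J *m (col_mx A v)^T = map_mx h (block_mx G (- c^T) c 0).
  move=> vc; rewrite mul_col_mx tr_col_mx mul_col_row AG vc map_block_mx.
  congr block_mx; first by rewrite skew_swap // vc map_mxN map_trmx.
  rewrite map_mx0 skew_diag0 //.
  by rewrite -(rmorph_nat h) fmorph_eq0.
have free (v : 'rV[K]_(n + n)) : ~~ (v <= A)%MS -> row_free (col_mx A v).
  move=> vA; have : (A < col_mx A v)%MS.
    rewrite ltmxE -addsmxE addsmxSl /=; apply: contra vA; apply: submx_trans.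
    by rewrite -?addsmxE addsmxSr.
  move/rank_ltmx => ltA; rewrite -row_leq_rank; apply: leq_trans ltA.
  by rewrite addn1 ltnS row_leq_rank.
suff [c [v [vc vA]]] : exists (c : 'rV[E]_N) (v : 'rV[K]_(n + n)),
    v *m J *m A^T = map_mx h c /\ ~~ (v <= A)%MS.
  by exists v, (block_mx G (- c^T) c 0); split; [apply: free | apply: gram].
have [uG|nuG] := boolP (G \in unitmx).
  have [|v vn0 vJA] := @kermx_nontrivial _ _ _ (J *m A^T); first exact: ltN.
  exists 0, v; rewrite -mulmxA vJA map_mx0; split=> //.
  apply: contra vn0 => /submxP[x vx]; apply/eqP; rewrite vx.
  suff -> : x = 0 by rewrite mul0mx.
  have := vJA; rewrite vx -mulmxA [A *m (_ *m _)]mulmxA AG => xG.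
  by rewrite -(mulmxK (_ : map_mx h G \in unitmx) x) ?map_unitmx // xG mul0mx.
have [i ciG] : exists i, ~~ (row i (1%:M : 'M[E]_N) <= G)%MS.
  apply: boolp.contrapT => nex; case/negP: nuG.
  rewrite -row_full_unit -sub1mx; apply/row_subP => i.
  by apply: boolp.contrapT => /negP iG; apply: nex; exists i.
have fJA : row_full (J *m A^T).
  by rewrite /row_full (eqmxMfull _ _) ?row_full_unit // mxrank_tr.
exists (row i 1%:M).
have /submxP[v vc] : (map_mx h (row i (1%:M : 'M[E]_N)) <= J *m A^T)%MS.
  exact: submx_full.
exists v; rewrite -mulmxA -vc; split=> //.
apply: contra ciG => /submxP[x vx]; rewrite -(map_submx h); apply/submxP; exists x.
by rewrite vc vx -mulmxA [A *m (_ *m _)]mulmxA AG.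
Qed.

(** The Gram matrix of fewer than 2n vectors may be degenerate, so they are completed to a basis
    whose Gram matrix still has entries in E and is invertible. *)
Lemma gram_extend N (A : 'M[K]_(N, n + n)) (G : 'M[E]_N) :
  row_free A -> A *m J *m A^T = map_mx h G ->
  exists (A0 : 'M[K]_(n + n)) (G0 : 'M[E]_(n + n)) (W : 'M[E]_(N, n + n)),
    [/\ A0 \in unitmx, A0 *m J *m A0^T = map_mx h G0 & A = map_mx h W *m A0].
Proof.
move=> fA; have NleN : (N <= n + n)%N.
  by move: fA; rewrite /row_free => /eqP <-; apply: rank_leq_col.
move: {2}(_ - N)%N (erefl (n + n - N)%N) => k.
elim: k => [|k IHk] in N A G fA NleN *.
  move=> eN; have {NleN} eN : N = (n + n)%N.
    by apply/eqP; rewrite eqn_leq NleN -subn_eq0 eN.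
  subst N => AG; exists A, G, 1%:M; split=> //; first by rewrite -row_free_unit.
  by rewrite map_mx1 mul1mx.
move=> eN AG; have ltN : (N < n + n)%N by rewrite -subn_gt0 eN.
have [v [G1 [fv AG1]]] := gram_extend1 fA AG ltN.
have [||A0 [G0 [W [uA0 AG0 eA]]]] := IHk _ _ G1 fv _ _ AG1.
- by rewrite addn1.
- by rewrite addn1 subnS eN.
exists A0, G0, (row_mx 1%:M 0 *m W); split=> //.
by rewrite map_mxM -mulmxA -eA map_row_mx map_mx1 map_mx0 mul_row_col mul1mx
  mul0mx addr0.
Qed.

(** Darboux over E writes G as C J C^T. Then Q = C^-1 A satisfies Q J Q^T = J, and C has entries in
    E. *)
Lemma gram_factor_unit (A : 'M[K]_(n + n)) (G : 'M[E]_(n + n)) :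
  A \in unitmx -> A *m J *m A^T = map_mx h G ->
  exists (C : 'M[E]_(n + n)) (Q : 'M[K]_(n + n)),
    symplectic Q^T /\ A = map_mx h C *m Q.
Proof.
move=> uA AG; have sG := gram_skew AG.
have uJ : J \in unitmx := symp_mx_unit K n.
have uG : G \in unitmx.
  by rewrite -(map_unitmx h) -AG !unitmx_mul uA uJ unitmx_tr.
have [C uC CG] := darboux char2 sG uG.
have uhC : map_mx h C \in unitmx by rewrite map_unitmx.
exists C, (invmx (map_mx h C) *m A); split; last by rewrite mulmxA mulmxV ?mul1mx.
apply/symplecticP; rewrite trmxK trmx_mul !mulmxA.
rewrite -(mulmxA (invmx _)) -(mulmxA (invmx _)) AG -CG !map_mxM map_symp_mx.
by rewrite !mulmxA mulVmx // mul1mx trmx_inv -map_trmx mulmxK // unitmx_tr.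
Qed.

Lemma gram_factor_free N (A : 'M[K]_(N, n + n)) (G : 'M[E]_N) :
  row_free A -> A *m J *m A^T = map_mx h G ->
  exists (C : 'M[E]_(N, n + n)) (Q : 'M[K]_(n + n)),
    symplectic Q^T /\ A = map_mx h C *m Q.
Proof.
move=> fA AG; have [A0 [G0 [W [uA0 AG0 ->]]]] := gram_extend fA AG.
have [C [Q [sQ ->]]] := gram_factor_unit uA0 AG0.
by exists (W *m C), Q; rewrite map_mxM mulmxA.
Qed.

(** A vector is determined by its pairings with the basis A0: A = H G^-1 A0, so a factorization of
    A0 gives one of A. *)
Lemma gram_factor_span M (A0 : 'M[K]_(n + n)) (A : 'M[K]_(M, n + n))
    (G : 'M[E]_(n + n)) (H : 'M[E]_(M, n + n)) :
  A0 \in unitmx -> A0 *m J *m A0^T = map_mx h G -> A *m J *m A0^T = map_mx h H ->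
  exists (C : 'M[E]_(M, n + n)) (Q : 'M[K]_(n + n)),
    symplectic Q^T /\ A = map_mx h C *m Q.
Proof.
move=> uA0 AG AH; have [C [Q [sQ eA0]]] := gram_factor_unit uA0 AG.
have uJ : J \in unitmx := symp_mx_unit K n.
exists (H *m invmx G *m C), Q; split=> //.
have uG : map_mx h G \in unitmx by rewrite -AG !unitmx_mul uA0 uJ unitmx_tr.
have HG : map_mx h H = A *m invmx A0 *m map_mx h G.
  by rewrite -AG -AH -(mulmxA A0) !mulmxA mulmxKV.
by rewrite !map_mxM -mulmxA -eA0 map_invmx HG mulmxK // mulmxKV.
Qed.

End GramFactorization.

(** * Rational functions as fractions *)

Lemma frac_numden (A : idomainType) (x : {fraction A}) :
  x = FracField.tofrac (\n_(repr x)) / FracField.tofrac (\d_(repr x)).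
Proof.
have d0 : FracField.tofrac (\d_(repr x)) != 0 by rewrite tofrac_eq0 denom_ratioP.
apply: (mulIf d0); rewrite mulfVK //.
rewrite -[X in X * _]reprK; move: (repr x) => r {d0}.
rewrite !piE; apply/eqP; rewrite eqmodE /= FracField.equivfE.
rewrite /FracField.mulf !numden_Ratio ?mulf_neq0 ?oner_eq0 ?denom_ratioP //.
by rewrite !mulr1 mulrC.
Qed.

Section Mmap.

Variables (A : nzRingType) (S T : comNzRingType) (k : nat).

Lemma mmap_ext (f g : A -> S) (u v : 'I_k -> S) p :
  f =1 g -> u =1 v -> mmap f u p = mmap g v p.
Proof.
move=> fg uv; apply: eq_bigr => m _; rewrite fg; congr (_ * _).
exact: mmap1_eq.
Qed.

Lemma rmorph_mmap (s : {rmorphism S -> T}) (f : A -> S) (v : 'I_k -> S) p :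
  s (mmap f v p) = mmap (s \o f) (s \o v) p.
Proof.
rewrite /mmap rmorph_sum; apply: eq_bigr => m _; rewrite rmorphM; congr (_ * _).
by rewrite rmorph_prod; apply: eq_bigr => i _; rewrite rmorphXn.
Qed.

Lemma polyfun_mmap (f : A -> S) a b (v : 'I_k -> 'M[S]_(a, b) -> S) p :
  (forall i, polyfun (v i)) -> polyfun (fun X => mmap f (fun i => v i X) p).
Proof.
move=> pv; apply: polyfun_sum => m; apply: polyfun_mul; first exact: polyfun_cst.
by apply: polyfun_prod => i; apply: polyfun_exp.
Qed.

End Mmap.

Definition frac_const (R : idomainType) (k : nat) :
    {rmorphism R -> {fraction {mpoly R[k]}}} :=
  [the {rmorphism _ -> _} of @FracField.tofrac _ \o @mpolyC k R].

Lemma mmap_tofrac (R : idomainType) (k k' : nat) (w : 'I_k' -> {mpoly R[k]}) p :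
  mmap (frac_const R k) (fun i => FracField.tofrac (w i)) p
    = FracField.tofrac (mmap (@mpolyC k R) w p).
Proof. by rewrite rmorph_mmap. Qed.

Lemma mmap_meval (R : comNzRingType) (k k' : nat) (w : 'I_k' -> {mpoly R[k]}) p x :
  (mmap (@mpolyC k R) w p).@[x] = p.@[fun i => (w i).@[x]].
Proof.
rewrite rmorph_mmap; apply: mmap_ext => // c /=.
by rewrite mevalC.
Qed.

(** A polynomial vanishing at all points over R vanishes at all points over its fraction field, and
    its value at the tuple of variables is the polynomial itself. *)
Lemma meval_eq0 (R : numFieldType) (k : nat) (p : {mpoly R[k]}) :
  (forall x, p.@[x] = 0) -> p = 0.
Proof.
move=> p0; apply/eqP; rewrite -tofrac_eq0; apply/eqP.
pose h := frac_const R k.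
have pf : polyfun (fun X : 'rV_k => mmap h (fun i => X 0 i) p).
  by apply: polyfun_mmap => i; apply: polyfun_entry.
have f0 : forall X : 'rV_k, mmap h (fun i => X 0 i) p = 0.
  apply: (polyfun_eq0_ext (h := h) pf) => X.
  have -> : mmap h (fun i => (map_mx h X) 0 i) p = h (p.@[fun i => X 0 i]).
    by rewrite rmorph_mmap; apply: mmap_ext => // i; rewrite /= mxE.
  by rewrite p0 rmorph0.
have := f0 (\row_i FracField.tofrac 'X_i).
rewrite (mmap_ext (g := h) (v := fun i => FracField.tofrac 'X_i)) //; last first.
  by move=> i; rewrite mxE.
rewrite mmap_tofrac => <-; congr FracField.tofrac.
rewrite -[LHS]comp_mpoly_id; apply: mmap_ext => // i.
by rewrite tnth_mktuple.
Qed.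

(** After clearing denominators, a vanishing sum of squares of polynomials becomes, at each real
    point, a vanishing sum of real squares. *)
Lemma frac_formally_real (R : realFieldType) (k : nat) :
  formally_real {fraction {mpoly R[k]}}.
Proof.
move=> l v vv.
pose d := \prod_i \d_(repr (v 0 i)).
have dn0 : FracField.tofrac d != 0.
  by rewrite tofrac_eq0; apply/prodf_neq0 => i _; apply: denom_ratioP.
have [a va] : exists a : 'I_l -> {mpoly R[k]},
    forall i, FracField.tofrac d * v 0 i = FracField.tofrac (a i).
  exists (fun i => \prod_(j | j != i) \d_(repr (v 0 j)) * \n_(repr (v 0 i))) => i.
  rewrite [v 0 i in LHS]frac_numden /d (bigD1 i) //= !rmorphM [LHS]mulrC mulrA divfK.
    by rewrite mulrC.
  by rewrite tofrac_eq0 denom_ratioP.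
have a0 i : a i = 0.
  apply: meval_eq0 => x.
  have sum0 : \sum_j a j ^+ 2 = 0.
    apply/eqP; rewrite -tofrac_eq0 rmorph_sum /=.
    under eq_bigr => j _ do rewrite tofracXn -va exprMn.
    rewrite -mulr_sumr mulf_eq0; apply/orP; right.
    move/matrixP: vv => /(_ 0 0); rewrite !mxE => vv; rewrite -[X in _ == X]vv.
    by apply/eqP; apply: eq_bigr => j _; rewrite mxE expr2.
  have /eqP : \sum_j (a j).@[x] ^+ 2 = 0.
    rewrite -[RHS](rmorph0 (meval x)) -sum0 rmorph_sum.
    by apply: eq_bigr => j _; rewrite rmorphXn.
  rewrite psumr_eq0 => [/allP/(_ i)|j _]; last exact: sqr_ge0.
  by rewrite mem_index_enum sqrf_eq0 => /(_ isT)/eqP.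
apply/rowP => i; rewrite mxE; apply: (mulfI dn0).
by rewrite va a0 mulr0 rmorph0.
Qed.

(** * Pullbacks as field morphisms *)

HB.instance Definition _ (R : realType) (m n : nat) :=
  GRing.RMorphism.copy (@ratpoly R m n) (@FracField.tofrac _).
HB.instance Definition _ (R : realType) (m n : nat) :=
  GRing.RMorphism.copy (@ratconst R m n) (frac_const R (m * (n + n))).
HB.instance Definition _ (R : realType) (m m' n : nat)
    (P : 'I_m' -> 'cV[ratfun R m n]_(n + n)) :=
  GRing.RMorphism.copy (poly_pullback P)
    (mmap (frac_const R (m * (n + n)))
          (fun v => mxvec (\matrix_(i, k) P i k 0) 0 v)).

Definition coords (K : Type) (m n : nat) (A : 'I_m -> 'cV[K]_(n + n)) :
    'I_(m * (n + n)) -> K :=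
  fun v => mxvec (\matrix_(i, k) A i k 0) 0 v.

Lemma coordsE (K : Type) (m n : nat) (A : 'I_m -> 'cV[K]_(n + n)) i k :
  coords A (mxvec_index i k) = A i k 0.
Proof. by rewrite /coords mxvecE mxE. Qed.

Lemma coords_onto (K : Type) (m n : nat) (x : 'I_(m * (n + n)) -> K) :
  exists A : 'I_m -> 'cV[K]_(n + n), x =1 coords A.
Proof.
exists (fun i => \col_k x (mxvec_index i k)) => v.
by case/mxvec_indexP: v => i k; rewrite coordsE mxE.
Qed.

Section Pullback.

Variable R : realType.

Section PolyPullback.

Variables (m m' n : nat) (P : 'I_m' -> 'cV[ratfun R m n]_(n + n)).

Lemma poly_pullbackX i k : poly_pullback P 'X_(mxvec_index i k) = P i k 0.
Proof.
rewrite /poly_pullback (mmapX _ (frac_const R _)) mmap1U.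
exact: coordsE.
Qed.

Lemma poly_pullbackC c : poly_pullback P c%:MP = ratconst m n c.
Proof. exact: (mmapC _ (frac_const R _)). Qed.

Definition dominant : Prop := forall p, poly_pullback P p = 0 -> p = 0.

(** A polynomial map onto the real points is dominant: a polynomial with zero pullback vanishes at
    every real point of the target. *)
Lemma dominant_real (w : 'I_m' -> 'I_(n + n) -> {mpoly R[m * (n + n)]}) :
  (forall i k, P i k 0 = ratpoly (w i k)) ->
  (forall Y : 'I_m' -> 'cV[R]_(n + n), exists A : 'I_m -> 'cV[R]_(n + n),
      forall i k, (w i k).@[coords A] = Y i k 0) ->
  dominant.
Proof.
move=> Pw onto p Pp0; apply: meval_eq0 => y.
have [Y yY] := coords_onto y; have [A wA] := onto Y.
pose w' := fun v => mxvec (\matrix_(i, k) w i k) 0 v.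
have w'0 : mmap (@mpolyC _ R) w' p = 0.
  apply/eqP; rewrite -tofrac_eq0 -mmap_tofrac -Pp0; apply/eqP.
  apply: mmap_ext => // v; case/mxvec_indexP: v => i k.
  by rewrite /w' !mxvecE !mxE Pw.
transitivity (mmap (@mpolyC _ R) w' p).@[coords A]; last by rewrite w'0 meval0.
rewrite mmap_meval; apply: mmap_ext => // v; rewrite yY.
by case/mxvec_indexP: v => i k; rewrite coordsE /w' mxvecE mxE wA.
Qed.

Hypothesis dP : dominant.

Lemma pullback_frac p q : q != 0 ->
  pullback P (ratpoly p / ratpoly q) = poly_pullback P p / poly_pullback P q.
Proof.
move=> qn0; rewrite /pullback; set f := ratpoly p / ratpoly q.
have dn0 : \d_(repr f) != 0 by apply: denom_ratioP.
have nz r : r != 0 -> poly_pullback P r != 0 by apply: contra => /eqP/dP->.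
have tn0 r : r != 0 -> ratpoly r != 0 :> ratfun R m' n by rewrite tofrac_eq0.
apply/eqP; rewrite eqr_div ?nz // -!rmorphM; apply/eqP; congr poly_pullback.
apply/eqP; rewrite -tofrac_eq !tofracM -eqr_div ?tofrac_eq0 //.
by rewrite -frac_numden.
Qed.

Lemma pullback_polyE p : pullback P (ratpoly p) = poly_pullback P p.
Proof.
rewrite -[ratpoly p]divr1 -[1 in LHS](tofrac1 _).
by rewrite pullback_frac ?oner_eq0 // rmorph1 divr1.
Qed.

Lemma ratfun_frac (x : ratfun R m' n) : exists p q, q != 0 /\ x = ratpoly p / ratpoly q.
Proof.
by exists \n_(repr x), \d_(repr x); split; [apply: denom_ratioP | apply: frac_numden].
Qed.

Lemma pullback_zmod : zmod_morphism (pullback P).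
Proof.
move=> x y; have [p [q [qn0 ->]]] := ratfun_frac x.
have [p' [q' [qn0' ->]]] := ratfun_frac y.
have tn0 r : r != 0 -> ratpoly r != 0 :> ratfun R m' n by rewrite tofrac_eq0.
have nz r : r != 0 -> poly_pullback P r != 0 by apply: contra => /eqP/dP->.
rewrite -mulNr addf_div ?tn0 //.
rewrite -!rmorphN -!rmorphM -rmorphD /=.
rewrite !pullback_frac ?mulf_neq0 // rmorphD !rmorphM rmorphN /=.
by rewrite -mulNr -addf_div ?nz.
Qed.

Lemma pullback_monoid : monoid_morphism (pullback P).
Proof.
split=> [|x y].
  by rewrite -[1](tofrac1 _) (pullback_polyE 1) rmorph1.
have [p [q [qn0 ->]]] := ratfun_frac x; have [p' [q' [qn0' ->]]] := ratfun_frac y.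
rewrite mulf_div -!rmorphM /= !pullback_frac ?mulf_neq0 // !rmorphM /=.
by rewrite mulf_div.
Qed.

(** The proof of dominance is an argument so that the ring morphism structure can be attached to
    this name. *)
Definition pullback_hom of dominant := pullback P.

End PolyPullback.

HB.instance Definition _ m m' n (P : 'I_m' -> 'cV[ratfun R m n]_(n + n))
    (dP : dominant P) :=
  GRing.isZmodMorphism.Build (ratfun R m' n) (ratfun R m n) (pullback_hom dP)
    (pullback_zmod dP).
HB.instance Definition _ m m' n (P : 'I_m' -> 'cV[ratfun R m n]_(n + n))
    (dP : dominant P) :=
  GRing.isMonoidMorphism.Build (ratfun R m' n) (ratfun R m n) (pullback_hom dP)
    (pullback_monoid dP).

Lemma pullback_homE m m' n (P : 'I_m' -> 'cV[ratfun R m n]_(n + n))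
    (dP : dominant P) f :
  pullback_hom dP f = pullback P f.
Proof. by []. Qed.

Section Composition.

Variables (m m' n : nat) (P : 'I_m' -> 'cV[ratfun R m n]_(n + n)) (dP : dominant P).

Lemma pullback_const c : pullback_hom dP (ratconst m' n c) = ratconst m n c.
Proof. by rewrite /pullback_hom pullback_polyE // poly_pullbackC. Qed.

Lemma map_pullback_const a b (M : 'M[R]_(a, b)) :
  map_mx (pullback_hom dP) (map_mx (@ratconst R m' n) M) = map_mx (@ratconst R m n) M.
Proof. by apply/matrixP => i j; rewrite !mxE pullback_const. Qed.

Lemma pullback_generic i : map_mx (pullback_hom dP) (@generic_point R m' n i) = P i.
Proof.
apply/matrixP => k j; rewrite ord1 !mxE /pullback_hom pullback_polyE //.
exact: poly_pullbackX.
Qed.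

Lemma pullback_poly_pullback m'' (Q : 'I_m'' -> 'cV[ratfun R m' n]_(n + n)) p :
  pullback_hom dP (poly_pullback Q p)
    = poly_pullback (fun i => map_mx (pullback_hom dP) (Q i)) p.
Proof.
rewrite rmorph_mmap; apply: mmap_ext => [c|v /=]; first exact: pullback_const.
by case/mxvec_indexP: v => i k; rewrite !mxvecE !mxE.
Qed.

Lemma pullback_comp m'' (Q : 'I_m'' -> 'cV[ratfun R m' n]_(n + n)) f :
  pullback_hom dP (pullback Q f) = pullback (fun i => map_mx (pullback_hom dP) (Q i)) f.
Proof.
by rewrite /pullback fmorph_div; congr (_ / _); apply: pullback_poly_pullback.
Qed.

End Composition.

Lemma eq_pullback m m' n (P Q : 'I_m' -> 'cV[ratfun R m n]_(n + n)) :
  P =1 Q -> pullback P =1 pullback Q.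
Proof. by move=> /boolp.funext ->. Qed.

Lemma poly_pullback_generic m n (p : {mpoly R[m * (n + n)]}) :
  poly_pullback (@generic_point R m n) p = ratpoly p.
Proof.
rewrite -[p in RHS]comp_mpoly_id [RHS]rmorph_mmap.
apply: mmap_ext => // v; case/mxvec_indexP: v => i k.
by rewrite mxvecE !mxE /= tnth_mktuple.
Qed.

Section Affine.

Variables (m n : nat) (S : 'M[R]_(n + n)) (b : 'cV[R]_(n + n)).

Definition affine_generic : 'I_m -> 'cV[ratfun R m n]_(n + n) :=
  affine_act (map_mx (@ratconst R m n) S) (map_mx (@ratconst R m n) b)
             (@generic_point R m n).

Lemma affine_dominant : S \in unitmx -> dominant affine_generic.
Proof.
move=> uS; apply: (@dominant_real _ _ _ _ (fun i k =>
   \sum_l S k l *: 'X_(mxvec_index i l) + (b k 0)%:MP)) => [i k|Y].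
  rewrite !mxE /ratpoly rmorphD rmorph_sum /=; congr (_ + _).
  apply: eq_bigr => l _; rewrite !mxE -mul_mpolyC rmorphM.
  by [].
exists (fun i => invmx S *m (Y i - b)) => i k.
rewrite mevalD mevalC raddf_sum /=.
transitivity ((S *m (invmx S *m (Y i - b)) + b) k 0).
  rewrite 2!mxE; congr (_ + _); apply: eq_bigr => l _.
  by rewrite mevalZ mevalXU coordsE.
by rewrite mulmxA mulmxV // mul1mx subrK.
Qed.

End Affine.

Section Difference.

Variables (m n : nat) (i1 : 'I_m).

Definition difference_map : 'I_m.-1 -> 'cV[ratfun R m n]_(n + n) :=
  fun i => @generic_point R m n (lift i1 i) - @generic_point R m n i1.

Lemma difference_dominant : dominant difference_map.
Proof.
apply: (@dominant_real _ _ _ _ (fun i k =>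
   'X_(mxvec_index (lift i1 i) k) - 'X_(mxvec_index i1 k))) => [i k|Y].
  by rewrite !mxE /ratpoly rmorphB.
exists (fun i => if unlift i1 i is Some j then Y j else 0) => i k.
by rewrite mevalB !mevalXU !coordsE liftK unlift_none mxE subr0.
Qed.

End Difference.
End Pullback.

(** * Invariants *)

Section Omega.

Variables (K : comNzRingType) (n : nat).
Implicit Types u v w : 'cV[K]_(n + n).

Lemma omegaDl u v w : omega (u + v) w = omega u w + omega v w.
Proof. by rewrite !omegaE linearD /= !mulmxDl mxE. Qed.

Lemma omegaDr u v w : omega u (v + w) = omega u v + omega u w.
Proof. by rewrite !omegaE mulmxDr mxE. Qed.

Lemma omega_skew u v : omega u v = - omega v u.
Proof.
rewrite /omega -sumrN; apply: eq_bigr => i _; ring.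
Qed.

Lemma omega_diag u : omega u u = 0.
Proof. by rewrite /omega big1 // => i _; ring. Qed.

Lemma omegaNl u v : omega (- u) v = - omega u v.
Proof. by rewrite !omegaE linearN /= !mulNmx mxE. Qed.

Lemma omegaNr u v : omega u (- v) = - omega u v.
Proof. by rewrite !omegaE mulmxN mxE. Qed.

Definition omega_bilinear := (omegaDl, omegaDr, omegaNl, omegaNr).

(** The terms pairing b with the points cancel around the cycle, by skew-symmetry. *)
Lemma pairing_cycle_affine m (S : 'M[K]_(n + n)) (b : 'cV[K]_(n + n))
    (A : 'I_m -> 'cV[K]_(n + n)) (i j k : 'I_m) :
  symplectic S ->
  let B := affine_act S b A in
  pairing B i j + pairing B j k + pairing B k i
    = pairing A i j + pairing A j k + pairing A k i.
Proof.
move=> sS; rewrite /= /pairing /affine_act !omega_bilinear !sS omega_diag.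
rewrite (omega_skew b (S *m A j)) (omega_skew b (S *m A k)) (omega_skew b (S *m A i)).
by ring.
Qed.

Lemma omega_difference m (A : 'I_m -> 'cV[K]_(n + n)) (i1 i j : 'I_m) :
  omega (A i - A i1) (A j - A i1)
    = pairing A i1 i + pairing A i j + pairing A j i1.
Proof.
rewrite /pairing !omega_bilinear omega_diag (omega_skew (A i) (A i1)).
rewrite (omega_skew (A j) (A i1)).
rewrite (omega_skew (A i1) (A j)).
by ring.
Qed.

End Omega.

Lemma rmorph_omega (K L : comNzRingType) (s : {rmorphism K -> L}) n
    (u v : 'cV[K]_(n + n)) :
  s (omega u v) = omega (map_mx s u) (map_mx s v).
Proof.
rewrite /omega rmorph_sum; apply: eq_bigr => i _.
by rewrite rmorphB !rmorphM !mxE.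
Qed.

Section Invariants.

Variables (R : realType).

Lemma ratfun_actE m n (S : 'M[R]_(n + n)) (b : 'cV[R]_(n + n)) (sS : symplectic S)
    (f : ratfun R m n) :
  ratfun_act S b f = pullback_hom (@affine_dominant R m n S b (symplectic_unit sS)) f.
Proof. by []. Qed.

Lemma ASp_invariant_cycle m n (i j k : 'I_m) :
  ASp_invariant (pairing (@generic_point R m n) i j
     + pairing (@generic_point R m n) j k + pairing (@generic_point R m n) k i).
Proof.
move=> S b sS; rewrite (ratfun_actE b sS) !rmorphD /= /pairing !rmorph_omega.
rewrite !pullback_generic.
exact: pairing_cycle_affine (map_symplectic _ sS).
Qed.

Lemma ASp_invariant_omega m n (i1 i j : 'I_m) :
  ASp_invariant (omega (@generic_point R m n i - @generic_point R m n i1)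
                       (@generic_point R m n j - @generic_point R m n i1)).
Proof. by rewrite omega_difference; apply: ASp_invariant_cycle. Qed.

Lemma Sp_invariant_omega m n (i j : 'I_m) :
  Sp_invariant (omega (@generic_point R m n i) (@generic_point R m n j)).
Proof.
move=> S sS; rewrite (ratfun_actE 0 sS) rmorph_omega !pullback_generic.
rewrite /affine_generic /affine_act map_mx0 !addr0.
exact: map_symplectic.
Qed.

(** Differences forget the translation, so the difference map intertwines the affine action on V^m
    with the linear action on V^(m-1). *)
Lemma ASp_invariant_pullback m n (i1 : 'I_m) (h : ratfun R m.-1 n) :
  Sp_invariant h -> ASp_invariant (pullback (@difference_map R m n i1) h).
Proof.
move=> ih S b sS; rewrite (ratfun_actE b sS) pullback_comp.
rewrite -{2}(ih S sS).
rewrite -[pullback _ (ratfun_act _ _ _)](pullback_homE (@difference_dominant R m n i1)).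
rewrite pullback_comp; apply: eq_pullback => i.
rewrite map_mxB !pullback_generic /affine_generic /affine_act.
rewrite map_mxD map_mxM map_mx0 map_mx0 addr0 map_pullback_const pullback_generic.
by rewrite mulmxBr opprD addrACA subrr addr0.
Qed.

Lemma ASp_invariant_divring m n :
  GRing.divring_closed [pred f : ratfun R m n | boolp.asbool (ASp_invariant f)].
Proof.
split=> [|f g|f g]; rewrite ?inE.
- by apply/boolp.asboolP => S b sS; rewrite (ratfun_actE b sS) rmorph1.
- move=> /boolp.asboolP iF /boolp.asboolP iG; apply/boolp.asboolP => S b sS.
  by rewrite (ratfun_actE b sS) rmorphB; congr (_ - _); [apply: iF | apply: iG].
- move=> /boolp.asboolP iF /boolp.asboolP iG; apply/boolp.asboolP => S b sS.
  by rewrite (ratfun_actE b sS) fmorph_div; congr (_ / _); [apply: iF | apply: iG].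
Qed.

Lemma generated_ASp_invariant m n (X : ratfun R m n -> Prop) f :
  (forall x, X x -> ASp_invariant x) -> generated_field X f -> ASp_invariant f.
Proof.
move=> iX /(_ _ (ASp_invariant_divring m n)) gf; apply/boolp.asboolP.
apply: gf => [c|x /iX ix]; last by rewrite inE; apply/boolp.asboolP.
rewrite inE; apply/boolp.asboolP => S b sS.
by rewrite (ratfun_actE b sS) pullback_const.
Qed.

End Invariants.

(** * Subfields given by predicates, as fields *)

Section Subfield.

Variables (K : fieldType) (F : {pred K}).
Hypothesis F_closed : GRing.divring_closed F.

HB.instance Definition _ := GRing.isDivringClosed.Build K F F_closed.

Lemma mmap_closed (A : nzRingType) k (f : A -> K) (v : 'I_k -> K) p :
  (forall c, f c \in F) -> (forall i, v i \in F) -> mmap f v p \in F.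
Proof.
move=> fF vF; rewrite rpred_sum // => m _; rewrite rpredM // rpred_prod // => i _.
by rewrite rpredX.
Qed.

Lemma mulmx_closed a b c (A : 'M[K]_(a, b)) (B : 'M[K]_(b, c)) :
  (forall i j, A i j \in F) -> (forall i j, B i j \in F) ->
  forall i j, (A *m B) i j \in F.
Proof. by move=> AF BF i j; rewrite mxE rpred_sum // => k _; rewrite rpredM. Qed.

(** Makes F a field in its own right, over which Darboux's theorem can be applied. *)
Definition subfield_type := {x : K | x \in F}.
HB.instance Definition _ := [isSub of subfield_type for sval].
HB.instance Definition _ := [Choice of subfield_type by <:].
HB.instance Definition _ := [SubChoice_isSubIntegralDomain of subfield_type by <:].
HB.instance Definition _ := [SubIntegralDomain_isSubField of subfield_type by <:].

Definition subfield_field : fieldType := subfield_type.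
Definition subfield_incl : {rmorphism subfield_field -> K} :=
  [the {rmorphism subfield_type -> K} of \val].

Lemma subfield_incl_mem x : subfield_incl x \in F.
Proof. exact: valP. Qed.

Lemma lift_subfield_mx a b (B : 'M[K]_(a, b)) :
  (forall i j, B i j \in F) -> exists B', B = map_mx subfield_incl B'.
Proof.
move=> BF; exists (\matrix_(i, j) (Sub (B i j) (BF i j) : subfield_type)).
by apply/matrixP => i j; rewrite !mxE.
Qed.

End Subfield.

(** * Generation of the invariant field *)

Section Generation.

Variables (R : realType) (m n : nat) (i1 : 'I_m).
Local Notation K := (ratfun R m n).
Local Notation X := (@generic_point R m n).
Local Notation T := (@difference_map R m n i1).
Local Notation kappa := (@ratconst R m n).

Definition difference_mx : 'M[K]_(m.-1, n + n) := \matrix_(i, k) T i k 0.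

Lemma difference_mx_gram i j :
  (difference_mx *m symp_mx K n *m difference_mx^T) i j = omega (T i) (T j).
Proof.
rewrite omegaE !mxE; apply: eq_bigr => k _.
rewrite ![_^T _ _]mxE [difference_mx j k]mxE.
by congr (_ * _); rewrite !mxE; apply: eq_bigr => l _; rewrite !mxE.
Qed.

(** General position: at the real tuple with first vector 0 followed by standard basis vectors, this
    minor is the determinant of an identity matrix. *)
Lemma difference_minor_neq0 k (kM : (k <= m.-1)%N) (kn : (k <= n + n)%N) :
  \det (\matrix_(i < k, j < k)
          difference_mx (widen_ord kM i) (widen_ord kn j)) != 0.
Proof.
pose W : 'M[{mpoly R[m * (n + n)]}]_k := \matrix_(i < k, j < k)
  ('X_(mxvec_index (lift i1 (widen_ord kM i)) (widen_ord kn j))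
   - 'X_(mxvec_index i1 (widen_ord kn j))).
have -> : (\matrix_(i < k, j < k) difference_mx (widen_ord kM i) (widen_ord kn j))
    = map_mx (@ratpoly R m n) W.
  by apply/matrixP => i j; rewrite !mxE rmorphB.
rewrite det_map_mx tofrac_eq0; apply/eqP => W0.
pose A : 'I_m -> 'cV[R]_(n + n) := fun i =>
  if unlift i1 i is Some j then \col_l (j == l :> nat)%:R else 0.
have : \det (map_mx (meval (coords A)) W) = 0 by rewrite det_map_mx W0 rmorph0.
suff -> : map_mx (meval (coords A)) W = 1%:M by rewrite det1 => /eqP; rewrite oner_eq0.
apply/matrixP => i j; rewrite !mxE mevalB !mevalXU !coordsE /A liftK unlift_none.
by rewrite !mxE subr0.
Qed.

Definition translate_fun (r : {mpoly R[m * (n + n)]}) (S : 'M[K]_(n + n))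
    (b : 'cV[K]_(n + n)) : K :=
  poly_pullback (fun i => S *m X i + b) r.

Lemma polyfun_translate a c r (S : 'M[K]_(a, c) -> 'M[K]_(n + n))
    (b : 'M[K]_(a, c) -> 'cV[K]_(n + n)) :
  polymap S -> polymap b -> polyfun (fun Y => translate_fun r (S Y) (b Y)).
Proof.
move=> pS pb; apply: polyfun_mmap => v; case/mxvec_indexP: v => i k.
apply: (polyfun_ext (f := fun Y => (S Y *m X i + b Y) k 0)).
  by move=> Y; rewrite mxvecE mxE.
apply: polymap_add => //; apply: polymap_mul => //; exact: polymap_cst.
Qed.

(** Density is used twice, for the linear part with b fixed and then for b with the linear part
    real. *)
Lemma affine_dense (f : 'M[K]_(n + n) -> 'cV[K]_(n + n) -> K) :
  (forall S, polyfun (f S)) -> (forall b, polyfun (f^~ b)) ->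
  (forall (S : 'M[R]_(n + n)) (b : 'cV[R]_(n + n)), symplectic S ->
     f (map_mx kappa S) (map_mx kappa b) = 0) ->
  forall S b, symplectic S -> f S b = 0.
Proof.
move=> pS pb f0 S b sS.
have fr : formally_real K by apply: frac_formally_real.
apply: (symplectic_dense (h := [the {rmorphism R -> K} of kappa]) fr sS (pb b)).
move=> S' sS'; move: b.
apply: (polyfun_eq0_ext (h := [the {rmorphism R -> K} of kappa])) => //.
by move=> b'; apply: f0.
Qed.

(** In cross-multiplied form, invariance is polynomial in S and b, so it extends to K even where q
    vanishes at the moved point. *)
Lemma invariant_cross (p q : {mpoly R[m * (n + n)]}) : q != 0 ->
  ASp_invariant (ratpoly p / ratpoly q) ->
  forall S b, symplectic S ->
    translate_fun p S b * ratpoly q = ratpoly p * translate_fun q S b.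
Proof.
move=> qn0 inv S b sS; apply/eqP; rewrite -subr_eq0; apply/eqP.
move: S b sS; apply: affine_dense => [S|b|S b sS].
- apply: polyfun_sub; apply: polyfun_mul; try exact: polyfun_cst.
    by apply: polyfun_translate; [apply: polymap_cst | apply: polymap_id].
  by apply: polyfun_translate; [apply: polymap_cst | apply: polymap_id].
- apply: polyfun_sub; apply: polyfun_mul; try exact: polyfun_cst.
    by apply: polyfun_translate; [apply: polymap_id | apply: polymap_cst].
  by apply: polyfun_translate; [apply: polymap_id | apply: polymap_cst].
have dP := @affine_dominant R m n S b (symplectic_unit sS).
have := inv S b sS; rewrite [LHS](pullback_frac dP) // => /eqP.
rewrite eqr_div; first last.
- by rewrite tofrac_eq0.
- by apply: contra qn0 => /eqP/dP->.
by move/eqP => e; apply/eqP; rewrite subr_eq0; apply/eqP.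
Qed.

(** If q vanished for all real g and b, density would allow g = S^-1 and b = X_1, where the
    translate is the generic point and the value is q itself. *)
Lemma exists_real_translate (q : {mpoly R[m * (n + n)]}) (S : 'M[K]_(n + n)) :
  q != 0 -> symplectic S ->
  exists (g : 'M[R]_(n + n)) (b : 'cV[R]_(n + n)), symplectic g /\
    poly_pullback
      (fun i => map_mx kappa g *m (S *m (X i - X i1)) + map_mx kappa b) q != 0.
Proof.
move=> qn0 sS; apply: boolp.contrapT => nex; case/eqP: qn0.
pose f (g : 'M[K]_(n + n)) (b : 'cV[K]_(n + n)) :=
  poly_pullback (fun i => g *m (S *m (X i - X i1)) + b) q.
have pf a c (g : 'M[K]_(a, c) -> 'M[K]_(n + n)) (b : 'M[K]_(a, c) -> 'cV[K]_(n + n)) :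
    polymap g -> polymap b -> polyfun (fun Y => f (g Y) (b Y)).
  move=> pg pb; apply: (polyfun_ext (f := fun Y =>
      translate_fun q (g Y *m S) (b Y - g Y *m (S *m X i1)))) => [Y|].
    rewrite /f /translate_fun; congr poly_pullback; apply: boolp.funext => i.
    by rewrite !mulmxBr !mulmxA addrA [RHS]addrAC.
  apply: polyfun_translate; first by apply: polymap_mul => //; apply: polymap_cst.
  move=> i j; apply: (polyfun_ext (f := fun Y => b Y i j - (g Y *m (S *m X i1)) i j)).
    by move=> Y; rewrite !mxE.
  apply: polyfun_sub; first exact: pb.
  by move: i j; apply: polymap_mul => //; apply: polymap_cst.
have f0 : forall g b, symplectic g -> f g b = 0.
  apply: affine_dense => [g|b|g b sg].
  - by apply: pf; [apply: polymap_cst | apply: polymap_id].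
  - by apply: pf; [apply: polymap_id | apply: polymap_cst].
  by apply/eqP; apply: contraT => fn0; case: nex; exists g, b.
have uS := symplectic_unit sS.
have sS' := symplectic_inv sS.
apply/eqP; rewrite -tofrac_eq0; apply/eqP; rewrite -[LHS]poly_pullback_generic.
rewrite -[RHS](f0 _ (X i1) sS') /f; congr poly_pullback; apply: boolp.funext => i.
by rewrite mulmxA mulVmx // mul1mx subrK.
Qed.

Section Membership.

Variable F : {pred K}.
Hypothesis F_closed : GRing.divring_closed F.
Hypothesis F_const : forall c, kappa c \in F.
Hypothesis F_omega : forall i j : 'I_m.-1, (i < j)%N -> (i < n + n)%N ->
  omega (T i) (T j) \in F.

HB.instance Definition _ := GRing.isDivringClosed.Build K F F_closed.

Lemma omega_mem (i j : 'I_m.-1) :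
  (i < n + n)%N || (j < n + n)%N -> omega (T i) (T j) \in F.
Proof.
have [ij|ji|/val_inj->] := ltngtP i j; last by rewrite omega_diag rpred0.
  by case/orP => [|/(ltn_trans ij)]; apply: F_omega.
rewrite omega_skew rpredN.
by case/orP => [/(ltn_trans ji)|]; apply: F_omega.
Qed.

(** At most 2n differences are linearly independent; otherwise the first 2n form a basis, and only
    pairings having an argument in it are used. *)
Lemma difference_factor :
  exists (S : 'M[K]_(n + n)) (C : 'M[K]_(m.-1, n + n)),
    [/\ symplectic S, forall i j, C i j \in F
      & forall i, T i = S *m (row i C)^T].
Proof.
pose E := subfield_field F_closed.
pose h : {rmorphism E -> K} := subfield_incl F_closed.
have char2 : 2 != 0 :> E.
  rewrite -(fmorph_eq0 h) rmorph_nat -(rmorph_nat [the {rmorphism R -> K} of kappa]).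
  by rewrite fmorph_eq0 pnatr_eq0.
have suff_factor (C : 'M[E]_(m.-1, n + n)) (Q : 'M[K]_(n + n)) :
    symplectic Q^T /\ difference_mx = map_mx h C *m Q ->
    exists (S : 'M[K]_(n + n)) (C : 'M[K]_(m.-1, n + n)),
      [/\ symplectic S, forall i j, C i j \in F & forall i, T i = S *m (row i C)^T].
  case=> sQ eC; exists Q^T, (map_mx h C); split=> // [i j|i].
    by rewrite mxE; apply: subfield_incl_mem.
  rewrite -trmx_mul -row_mul -eC; apply/colP => k; rewrite !mxE.
  by [].
have [Mn|nM] := leqP m.-1 (n + n).
  have free : row_free difference_mx.
    have := difference_minor_neq0 (leqnn _) Mn; set B := \matrix_(_, _) _ => B0.
    have uB : B \in unitmx by rewrite unitmxE unitfE.
    have eB : B = difference_mx *m (colsub (widen_ord Mn) 1%:M).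
      rewrite mulmx_colsub mulmx1; apply/matrixP => i j; rewrite [LHS]mxE [RHS]mxE.
      by congr (difference_mx _ _); apply: val_inj.
    rewrite -row_leq_rank -[X in (X <= _)%N](mxrank_unit uB) eB.
    exact: mxrankM_maxl.
  have [|G eG] := @lift_subfield_mx _ _ F_closed _ _
    (difference_mx *m symp_mx K n *m difference_mx^T).
    move=> i j; rewrite difference_mx_gram omega_mem //.
    by rewrite (leq_trans (ltn_ord i) Mn).
  have [C [Q CQ]] := gram_factor_free char2 free eG.
  exact: suff_factor CQ.
pose A0 := rowsub (widen_ord (ltnW nM)) difference_mx.
have uA0 : A0 \in unitmx.
  rewrite unitmxE unitfE; have := difference_minor_neq0 (ltnW nM) (leqnn _).
  congr (\det _ != 0); apply/matrixP => i j; rewrite [LHS]mxE [RHS]mxE.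
  by congr (difference_mx _ _); apply: val_inj.
have rowT B (i : 'I_(n + n)) j :
    (B *m symp_mx K n *m A0^T) j i
      = (B *m symp_mx K n *m difference_mx^T) j (widen_ord (ltnW nM) i).
  by move: B j => B j; rewrite !mxE; apply: eq_bigr => k _; rewrite !mxE.
have [|G eG] := @lift_subfield_mx _ _ F_closed _ _ (A0 *m symp_mx K n *m A0^T).
  move=> i j; rewrite rowT /A0 !mul_rowsub_mx mxE difference_mx_gram omega_mem //.
  by rewrite /= ltn_ord.
have [|H eH] := @lift_subfield_mx _ _ F_closed _ _
  (difference_mx *m symp_mx K n *m A0^T).
  by move=> i j; rewrite rowT difference_mx_gram omega_mem // /= ltn_ord orbT.
have [C [Q CQ]] := gram_factor_span char2 uA0 eG eH.
exact: suff_factor CQ.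
Qed.

Lemma ASp_invariant_mem f : ASp_invariant f -> f \in F.
Proof.
have [p [q [qn0 ->]]] := ratfun_frac f => inv.
have [S0 [C [sS0 CF TC]]] := difference_factor.
have uS0 := symplectic_unit sS0.
pose S := invmx S0.
have sS : symplectic S := symplectic_inv sS0.
have [g [b [sg qn0']]] := exists_real_translate qn0 sS.
(* Y is an affine symplectic translate of X over K, so invariance applies, while g and b are real,
   so its entries stay in F. *)
pose Y i := map_mx kappa g *m (S *m (X i - X i1)) + map_mx kappa b.
have YE r : poly_pullback Y r
    = translate_fun r (map_mx kappa g *m S)
        (map_mx kappa b - map_mx kappa g *m (S *m X i1)).
  congr poly_pullback; apply: boolp.funext => i.
  by rewrite /Y !mulmxBr !mulmxA addrA [RHS]addrAC.
have sgS : symplectic (map_mx kappa g *m S).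
  apply: symplectic_mul => //.
  by apply: (map_symplectic [the {rmorphism R -> K} of kappa]).
have := invariant_cross qn0 inv
  (map_mx kappa b - map_mx kappa g *m (S *m X i1)) sgS.
rewrite -!YE => e.
have -> : ratpoly p / ratpoly q = poly_pullback Y p / poly_pullback Y q.
  by apply/eqP; rewrite eqr_div ?tofrac_eq0 // -e mulrC.
have YF i k : Y i k 0 \in F.
  rewrite mxE rpredD ?[map_mx kappa b _ _]mxE ?F_const //.
  apply: mulmx_closed => // [{}k l|l j]; first by rewrite mxE.
  case: (unliftP i1 i) => [j'|] ->; last by rewrite subrr mulmx0 mxE rpred0.
  by rewrite -/(T j') TC mulmxA mulVmx // mul1mx !mxE.
have pF r : poly_pullback Y r \in F.
  apply: mmap_closed => // v; case/mxvec_indexP: v => i k.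
  by rewrite mxvecE mxE.
by rewrite rpred_div.
Qed.

End Membership.

End Generation.

(** * Transcendence basis *)

(** Darboux realizes the leading 2n x 2n block by a basis, and every other vector is found from its
    pairings with that basis. The values g are indexed by [nat] so that the block makes sense even
    for M < 2n. *)
Lemma exists_real_gram (R : numFieldType) (n M : nat) (g : nat -> nat -> R) :
  (forall i j, g i j = - g j i) ->
  \det (\matrix_(i < n + n, j < n + n) g i j) != 0 ->
  exists B : 'I_M -> 'cV[R]_(n + n),
    forall i j : 'I_M, (i < n + n)%N -> omega (B i) (B j) = g i j.
Proof.
move=> sg; set G := \matrix_(i, j) _ => G0.
have uG : G \in unitmx by rewrite unitmxE unitfE.
have sG : G^T = - G by apply/matrixP => i j; rewrite !mxE sg.
have char2 : 2 != 0 :> R by rewrite pnatr_eq0.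
have [C uC CG] := darboux char2 sG uG.
set J := symp_mx R n in CG.
pose H : 'M[R]_(M, n + n) := \matrix_(i, j) g i j.
have uJC : J *m C^T \in unitmx by rewrite unitmx_mul symp_mx_unit unitmx_tr.
pose B := H *m invmx (J *m C^T).
have BH : B *m J *m C^T = H by rewrite -mulmxA mulmxKV.
exists (fun i => (row i B)^T) => i j ilt.
pose i' : 'I_(n + n) := Ordinal ilt.
have Bi : row i B = row i' C.
  apply: (can_inj (mulmxK uJC)); rewrite -!row_mul !mulmxA BH CG.
  by apply/rowP => k; rewrite !mxE.
rewrite omega_skew omegaE !trmxK Bi (sg i j); congr (- _).
have -> : g j i = H j i' by rewrite mxE.
by rewrite -BH tr_row -!row_mul colE mulmxA -colE !mxE.
Qed.

Section TranscendenceBasis.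

Variables (R : realType) (m n : nat) (i1 : 'I_m).
Local Notation K := (ratfun R m n).
Local Notation X := (@generic_point R m n).
Local Notation T := (@difference_map R m n i1).
Local Notation M := m.-1.

(** Specialization: with the first vector set to 0, the differences take arbitrary real values B. *)
Lemma omega_relation_real d (u v : 'I_d -> 'I_M) (p : {mpoly R[d]}) :
  mmap (@ratconst R m n) (fun k => omega (T (u k)) (T (v k))) p = 0 ->
  forall B : 'I_M -> 'cV[R]_(n + n), p.@[fun k => omega (B (u k)) (B (v k))] = 0.
Proof.
pose W i : 'cV[{mpoly R[m * (n + n)]}]_(n + n) :=
  \col_k ('X_(mxvec_index (lift i1 i) k) - 'X_(mxvec_index i1 k)).
pose w k := omega (W (u k)) (W (v k)).
have TW i : T i = map_mx (@ratpoly R m n) (W i).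
  by apply/colP => k; rewrite !mxE rmorphB.
move=> p0 B; pose A : 'I_m -> 'cV[R]_(n + n) := fun i =>
  if unlift i1 i is Some j then B j else 0.
have w0 : mmap (@mpolyC _ R) w p = 0.
  apply/eqP; rewrite -tofrac_eq0 -mmap_tofrac -p0; apply/eqP.
  by apply: mmap_ext => // k; rewrite !TW -rmorph_omega.
have <- : (mmap (@mpolyC _ R) w p).@[coords A] = 0 by rewrite w0 rmorph0.
rewrite mmap_meval; apply: mmap_ext => // k; rewrite rmorph_omega.
have BW i : map_mx (meval (coords A)) (W i) = B i.
  apply/colP => l; rewrite !mxE mevalB !mevalXU !coordsE /A liftK unlift_none.
  by rewrite mxE subr0.
by rewrite !BW.
Qed.

Lemma omega_alg_independent d (u v : 'I_d -> 'I_M) :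
  injective (fun k => (u k, v k)) ->
  (forall k, (u k < v k)%N) -> (forall k, (u k < n + n)%N) ->
  algebraically_independent (fun k => omega (T (u k)) (T (v k))).
Proof.
move=> uv_inj ltuv ltun p /omega_relation_real p0; apply: meval_eq0 => c.
(* The relation p holds on the Gram values of Z - Z^T as soon as its leading  *)
(* 2n x 2n minor is nonzero, hence for all Z.                                 *)
pose D := (n + n + M)%N.
(* The size 2n + M of Z accommodates both the indices of the vectors and the leading 2n x 2n block;
   both embeddings preserve values. *)
pose eM (i : 'I_M) : 'I_D := widen_ord (leq_addl _ _) i.
pose e0 (i : 'I_(n + n)) : 'I_D := lshift M i.
pose f (Z : 'M[R]_D) :=
  p.@[fun k => Z (eM (u k)) (eM (v k)) - Z (eM (v k)) (eM (u k))].
pose g (Z : 'M[R]_D) := \det (ulsubmx (Z - Z^T)).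
have pf : polyfun f.
  by apply: polyfun_mmap => k; apply: polyfun_sub; apply: polyfun_entry.
have pg : polyfun g.
  apply: polyfun_det => i j.
  apply: (polyfun_ext (f := fun Z : 'M[R]_D => Z (e0 i) (e0 j) - Z (e0 j) (e0 i))).
    by move=> Z; rewrite !mxE.
  by apply: polyfun_sub; apply: polyfun_entry.
have fg0 Z : f Z * g Z = 0.
  have [->|gZ] := eqVneq (g Z) 0; first by rewrite mulr0.
  pose z i j := if insub i is Some i' then
    if insub j is Some j' then Z i' j' - Z j' i' else 0 else 0 : R.
  have zE (i j : 'I_D) : z i j = Z i j - Z j i by rewrite /z !valK.
  have [||B HB] := @exists_real_gram R n M z.
  - move=> i j; rewrite /z; case: insub => [i'|]; case: insub => [j'|];
      by rewrite ?oppr0 ?opprB.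
  - move: gZ; rewrite /g; congr (\det _ != 0); apply/matrixP => i j.
    by rewrite !mxE (zE (e0 i) (e0 j)).
  suff -> : f Z = 0 by rewrite mul0r.
  rewrite -[RHS](p0 B); apply: mmap_ext => // k.
  by rewrite HB // -(zE (eM _) (eM _)).
have g0 : exists Z, g Z != 0.
  (* For this Z the leading block of Z - Z^T is the standard symplectic matrix. *)
  exists (block_mx (block_mx 0 1%:M 0 0) 0 0 0); rewrite /g.
  have -> : ulsubmx (block_mx (block_mx 0 1%:M 0 0) 0 0 0
                     - (block_mx (block_mx 0 1%:M 0 0) 0 0 0 : 'M[R]_D)^T)
      = symp_mx R n.
    rewrite tr_block_mx opp_block_mx add_block_mx block_mxKul tr_block_mx !trmx0 trmx1.
    by rewrite opp_block_mx add_block_mx !oppr0 !add0r !addr0.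
  by rewrite -unitfE -unitmxE symp_mx_unit.
have f0 := polyfun_idomain [the {rmorphism R -> R} of idfun] pf pg fg0 g0.
(* Z carries c k at the position (u k, v k). As u k < v k, the transposed positions are 0, so Z -
   Z^T has the prescribed values. *)
pose Z : 'M[R]_D := \matrix_(a, b)
  \sum_(k | (a == eM (u k)) && (b == eM (v k))) c k.
rewrite -[RHS](f0 Z); apply: mmap_ext => // k; rewrite !mxE.
rewrite (big_pred1 k) => [|k']; last first.
  rewrite /= -!val_eqE /= !val_eqE -xpair_eqE; apply/eqP/eqP => [e|->] //.
  exact/esym/uv_inj.
rewrite big_pred0 ?subr0 // => k'; apply/negbTE/negP => /andP[/eqP e1 /eqP e2].
move: (ltuv k) (ltuv k') (congr1 val e1) (congr1 val e2) => /= + + vu uv.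
by rewrite -vu -uv => lt1 lt2; have := ltn_trans lt1 lt2; rewrite ltnn.
Qed.

Definition basis_pairs : {set 'I_M * 'I_M} :=
  [set ij : 'I_M * 'I_M | (ij.1 < ij.2)%N && (ij.1 < n + n)%N].

(** Stated additively, so that only the row lengths involve truncated subtraction. *)
Lemma sum_pairs_lt N k : (k <= N)%N ->
  ((\sum_(i < k) (N - i.+1)) * 2 + k * k.+1 = 2 * k * N)%N.
Proof.
elim: k => [|k IHk] kN; first by rewrite big_ord0.
move: (IHk (ltnW kN)); rewrite big_ord_recr /=.
rewrite -(subnKC kN) addKn; move: (N - k.+1)%N => r.
by move: (\sum_(i < k) _)%N => s; nia.
Qed.

(** Row i contributes M - i - 1 pairs; the rows are the first 2n when 2n <= M, and all of them
    otherwise. *)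
Lemma card_basis_pairs : #|basis_pairs| = d_inv M n.
Proof.
have row_card (i : 'I_M) : (\sum_(j : 'I_M | i < j) 1 = M - i.+1)%N.
  by rewrite -(big_geq_mkord i.+1 M xpredT (fun=> 1%N)) sum_nat_const_nat muln1.
rewrite -sum1_card.
rewrite (eq_bigl (fun ij : 'I_M * 'I_M => (ij.1 < n + n) && (ij.1 < ij.2))%N).
  rewrite -(pair_big_dep (fun i : 'I_M => i < n + n)%N
    (fun i j : 'I_M => i < j)%N (fun _ _ => 1%N)) /=.
  under eq_bigr => i _ do rewrite row_card.
  have [nM|Mn] := leqP (n + n) M.
    rewrite /d_inv mul2n -addnn nM.
    rewrite -(big_ord_widen M (fun i => M - i.+1)%N nM).
    by have := sum_pairs_lt nM; move: (\sum_(i < _) _)%N => s; nia.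
  rewrite (eq_bigl xpredT) => [|i]; last by rewrite (ltn_trans (ltn_ord i) Mn).
  rewrite d_inv_small; last by rewrite mul2n -addnn ltnW.
  have := sum_pairs_lt (leqnn M); move: (\sum_(i < _) _)%N => s es.
  have {}es : (M * M.-1 = s * 2)%N by case: M es => [|k]; rewrite /=; nia.
  by rewrite bin2 es muln2 doubleK.
by move=> ij; rewrite inE andbC.
Qed.

End TranscendenceBasis.

(** * Assembly of the invariance, generation and transcendence degree statements *)

Theorem mainTheorem7 (R : realType) (n m : nat) (hn : (1 <= n)%N)
    (hm : (2 <= m)%N) :
  let i1 : 'I_m := Ordinal (ltnW hm) in
  let X := @generic_point R m n in
  let a := pairing X in
  let T : 'I_m.-1 -> 'cV[ratfun R m n]_(n + n) := fun i => X (lift i1 i) - X i1 in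
  [/\ (* a_ij + a_jk + a_ki is an invariant function on V^m ... *)
      forall (S : 'M[R]_(n + n)) (b : 'cV[R]_(n + n))
             (A : 'I_m -> 'cV[R]_(n + n)) (i j k : 'I_m),
        symplectic S ->
        let B := affine_act S b A in
        pairing B i j + pairing B j k + pairing B k i
          = pairing A i j + pairing A j k + pairing A k i,
      (* ... and an invariant element of R(V^m) *)
      forall i j k : 'I_m, ASp_invariant (a i j + a j k + a k i),
      (* the invariant field is generated by the Sp-invariants of T *)
      forall f : ratfun R m n,
        ASp_invariant f <->
        generated_field
          (fun x => exists2 h : ratfun R m.-1 n,
                      Sp_invariant h & x = pullback T h) f,
      (* that is, by the omega (A_i - A_1, A_j - A_1) with 1 < i < j <= m *)
      (forall i j : 'I_m,
          omega (X i - X i1) (X j - X i1) = a i1 i + a i j + a j i1) /\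
      (forall f : ratfun R m n,
        ASp_invariant f <->
        generated_field
          (fun x => exists i j : 'I_m,
                      (i1 < i < j)%N /\ x = omega (X i - X i1) (X j - X i1)) f)
    & has_trdeg (@ASp_invariant R m n) (d_inv m.-1 n)].
Proof.
move=> i1 X a T.
have liftE (i : 'I_m.-1) : lift i1 i = i.+1 :> nat by [].
(* Used for all three generating sets: pullbacks of Sp-invariants, all pairings of differences, and
   the transcendence basis. *)
have inv_gen (Y : ratfun R m n -> Prop) f :
    (forall i j : 'I_m.-1, (i < j)%N -> (i < n + n)%N -> Y (omega (T i) (T j))) ->
    ASp_invariant f -> generated_field Y f.
  move=> YT inv F cF kF YF.
  apply: (ASp_invariant_mem (i1 := i1) cF kF) inv => i j ij iN.
  by apply: YF; apply: YT.
split.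
- by move=> S b A i j k sS; apply: pairing_cycle_affine.
- exact: ASp_invariant_cycle.
- move=> f; split.
    apply: inv_gen => i j _ _.
    (* The pairing of two differences is the pullback of the pairing of two generic vectors on
       V^(m-1). *)
    exists (omega (@generic_point R m.-1 n i) (@generic_point R m.-1 n j)).
      exact: Sp_invariant_omega.
    have := pullback_homE (@difference_dominant R m n i1)
      (omega (@generic_point R m.-1 n i) (@generic_point R m.-1 n j)).
    by rewrite rmorph_omega !pullback_generic.
  by apply: generated_ASp_invariant => _ [h ih ->]; apply: ASp_invariant_pullback.
- split=> [i j|f]; first exact: omega_difference.
  split.
    apply: inv_gen => i j ij _; exists (lift i1 i), (lift i1 j).
    by split=> //; apply/andP; split; rewrite !liftE.
  by apply: generated_ASp_invariant => _ [i [j [_ ->]]]; apply: ASp_invariant_omega.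
pose pair k := enum_val (cast_ord (esym (card_basis_pairs m n)) k).
exists (fun k => omega (T (pair k).1) (T (pair k).2)); split.
- by move=> k; apply: ASp_invariant_omega.
- have pairP k : ((pair k).1 < (pair k).2)%N && ((pair k).1 < n + n)%N.
    by have := enum_valP (cast_ord (esym (card_basis_pairs m n)) k); rewrite inE.
  apply: omega_alg_independent => [k l|k|k]; try by case/andP: (pairP k).
  by rewrite -!surjective_pairing => /enum_val_inj/cast_ord_inj.
(* An invariant already lies in the field generated by the basis, so a polynomial of degree 1
   witnesses algebraicity. *)
move=> f inv; exists ('X - f%:P); split; last by rewrite root_XsubC.
  by rewrite polyXsubC_eq0.
have gf := inv_gen _ _ _ inv => k F cF kF tF.
have fF : f \in F.
  apply: gf (cF) (kF) (tF) => i j ij iN.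
  have ijP : (i, j) \in basis_pairs m n by rewrite inE /= ij.
  exists (cast_ord (card_basis_pairs m n) (enum_rank_in ijP (i, j))).
  by rewrite /pair cast_ordK enum_rankK_in.
have [F1 FB _] := cF.
have F0 : 0 \in F by rewrite -(subrr 1); apply: FB.
by rewrite coefB coefX coefC; case: k => [|[|k]] /=; apply: FB.
Qed.
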